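(* Let $F:\mathbb{R}^n\times\mathbb{R}^m\to\mathbb{R}$, $\phi:\mathbb{R}^n\times\mathbb{R}^m\to\mathbb{R}^m$, $G:\mathbb{R}^n\times\mathbb{R}^m\to\mathbb{R}^p$ be continuously differentiable, $g:\mathbb{R}^m\to\mathbb{R}^q$ twice continuously differentiable, $\Gamma=\{y\mid g(y)\le0\}$, and consider the problem (MPEC'): $\min_{x,y}F(x,y)$ s.t. $\hat P(x,y):=((y,-\phi(x,y)),G(x,y))\in\hat D:=\operatorname{gph}\widehat N_\Gamma\times\mathbb{R}^p_-$. Assume that $(\bar x,\bar y)$ is B-stationary for (MPEC'), that (i) the mapping $y\rightrightarrows g(y)-\mathbb{R}^q_-$ is metrically subregular at $(\bar y,0)$, and (ii) GGCQ holds at $(\bar x,\bar y)$ for the system $\hat P(x,y)\in\hat D$ and the mapping $(u,v)\rightrightarrows\nabla\hat P(\bar x,\bar y)(u,v)-T_{\hat D}(\hat P(\bar x,\bar y))$ is metrically subregular at $((0,0),0)$. Set $\bar y^\ast:=-\phi(\bar x,\bar y)$ and assume there is a set $\tilde\Lambda\subseteq\bar\Lambda$ such that $\bar\Lambda(v)=\tilde\Lambda$ for all $v\in\bar K_\Gamma\setminus\{0\}$. Then for every $\tilde\lambda\in\tilde\Lambda$ there exist $v\in\bar K_\Gamma$, $z^\ast\in N_{\bar K_\Gamma}(v)$ and multipliers $w\in\mathcal{K}_{\bar K_\Gamma}(v,z^\ast)$, $\mu\in N_{\mathbb{R}^p_-}(G(\bar x,\bar y))$ such that \[0=\nabla_xF(\bar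 x,\bar y)-\nabla_x\phi(\bar x,\bar y)^Tw+\nabla_xG(\bar x,\bar y)^T\mu,\] \[0\in\nabla_yF(\bar x,\bar y)-\nabla^2(\tilde\lambda^Tg)(\bar y)w-\nabla_y\phi(\bar x,\bar y)^Tw+\nabla_yG(\bar x,\bar y)^T\mu+(\mathcal{K}_{\bar K_\Gamma}(v,z^\ast))^\ast.\]
   Context: Tangent cone $T_\Omega(\bar z)=\{w\mid \exists t_k\downarrow0,\ w_k\to w,\ \bar z+t_kw_k\in\Omega\}$; polar cone $K^\ast=\{z^\ast\mid\langle z^\ast,w\rangle\le0\ \forall w\in K\}$; regular normal cone $\widehat N_\Omega(\bar z)=(T_\Omega(\bar z))^\ast$ (for convex $\Omega$ the usual normal cone, denoted $N_\Omega$); $\operatorname{gph}$ denotes graph. For a set $\Omega$, $\bar z\in\Omega$ and $\bar z^\ast\in\widehat N_\Omega(\bar z)$, the critical cone is $\mathcal{K}_\Omega(\bar z,\bar z^\ast)=T_\Omega(\bar z)\cap\{\bar z^\ast\}^\perp$. Here $\bar K_\Gamma:=\mathcal{K}_\Gamma(\bar y,\bar y^\ast)$, $\bar\Lambda=\{\lambda\in N_{\mathbb{R}^q_-}(g(\bar y))\mid\nabla g(\bar y)^T\lambda=\bar y^\ast\}$, and for $v\in\bar K_\Gamma$, $\bar\Lambda(v)=\operatorname{argmax}\{v^T\nabla^2(\lambda^Tg)(\bar y)v\mid\lambda\in\bar\Lambda\}$. Let $\Omega_M$ be the feasible set of (MPEC'); $(\bar x,\bar y)$ is B-stationary if $0\in\nabla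 F(\bar x,\bar y)+\widehat N_{\Omega_M}(\bar x,\bar y)$. GGCQ at $(\bar x,\bar y)$ means $\widehat N_{\Omega_M}(\bar x,\bar y)=(\{(u,v)\mid\nabla\hat P(\bar x,\bar y)(u,v)\in T_{\hat D}(\hat P(\bar x,\bar y))\})^\ast$. A mapping $M$ is metrically subregular at $(\bar z,\bar w)\in\operatorname{gph}M$ if there are a neighborhood $W$ of $\bar z$ and $\kappa>0$ with $\operatorname{dist}(z,M^{-1}(\bar w))\le\kappa\operatorname{dist}(\bar w,M(z))$ for $z\in W$. *)

(* Defs.v *)
From HB Require Import structures.
From mathcomp Require Import all_boot all_order all_algebra.
From mathcomp Require Import all_classical all_reals all_analysis.
Set Implicit Arguments. Unset Strict Implicit. Unset Printing Implicit Defensive.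
Import Order.TTheory GRing.Theory Num.Theory.
Import numFieldNormedType.Exports.
Local Open Scope classical_set_scope.
Local Open Scope ring_scope.

Section Defs.
Variable R : realType.

Definition dotp k (a b : 'rV[R]_k) : R := \sum_(i < k) a ord0 i * b ord0 i.
Definition enorm k (a : 'rV[R]_k) : R := Num.sqrt (dotp a a).

Definition nonpos_orthant k : set 'rV[R]_k := [set s | forall i, s ord0 i <= 0].

Definition tangent_cone k (Om : set 'rV[R]_k) (z : 'rV[R]_k) : set 'rV[R]_k :=
  [set w | exists (t : nat -> R) (wk : nat -> 'rV[R]_k),
      (forall j, 0 < t j) /\ t @ \oo --> 0 /\ wk @ \oo --> w /\
      (forall j, Om (z + t j *: wk j))].

Definition polar k (K : set 'rV[R]_k) : set 'rV[R]_k :=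
  [set zs | forall w, K w -> dotp zs w <= 0].

(* regular normal cone; empty outside the set (normal cones are only
   defined at points of the set) *)
Definition rnormal k (Om : set 'rV[R]_k) (z : 'rV[R]_k) : set 'rV[R]_k :=
  [set zs | Om z /\ polar (tangent_cone Om z) zs].

Definition orth k (zs : 'rV[R]_k) : set 'rV[R]_k := [set w | dotp zs w = 0].

Definition crit_cone k (Om : set 'rV[R]_k) (z zs : 'rV[R]_k) : set 'rV[R]_k :=
  tangent_cone Om z `&` orth zs.

Definition gph a b (M : 'rV[R]_a -> set 'rV[R]_b) : set 'rV[R]_(a + b) :=
  [set u | exists z w, M z w /\ u = row_mx z w].

(* Euclidean distance from a point to a set (+oo for the empty set) *)
Definition dist_set k (z : 'rV[R]_k) (A : set 'rV[R]_k) : \bar R :=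
  ereal_inf [set (enorm (z - a))%:E | a in A].

Definition metric_subregular a b (M : 'rV[R]_a -> set 'rV[R]_b)
    (zb : 'rV[R]_a) (wb : 'rV[R]_b) : Prop :=
  M zb wb /\
  exists (W : set 'rV[R]_a) (kappa : R), nbhs zb W /\ 0 < kappa /\
    forall z, W z ->
      (dist_set z [set z' | M z' wb] <= kappa%:E * dist_set wb (M z))%E.

(* gradient of a scalar function (as a row vector) and Jacobian of a
   vector function, row convention: row i of jac f z is the derivative
   of f in direction e_i, so 'd f z u = u *m jac f z; the usual
   (column-convention) Jacobian nabla f(z) is (jac f z)^T. *)
Definition grad k (f : 'rV[R]_k -> R) (z : 'rV[R]_k) : 'rV[R]_k :=
  \row_i ('d f z (delta_mx ord0 i)).
Definition jac k l (f : 'rV[R]_k -> 'rV[R]_l) (z : 'rV[R]_k) : 'M[R]_(k, l) :=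
  \matrix_(i, j) ('d f z (delta_mx ord0 i)) ord0 j.
Definition hess k (f : 'rV[R]_k -> R) (z : 'rV[R]_k) : 'M[R]_(k, k) :=
  jac (grad f) z.

Definition C1 k l (f : 'rV[R]_k -> 'rV[R]_l) : Prop :=
  (forall z, differentiable f z) /\ continuous (jac f).
Definition C1s k (f : 'rV[R]_k -> R) : Prop :=
  (forall z, differentiable f z) /\ continuous (grad f).
Definition C2 k l (f : 'rV[R]_k -> 'rV[R]_l) : Prop :=
  C1 f /\ forall j : 'I_l, C1 (grad (fun z => f z ord0 j)).

Definition Gamma m q (g : 'rV[R]_m -> 'rV[R]_q) : set 'rV[R]_m :=
  [set y | nonpos_orthant (g y)].

Definition Dhat m q p (g : 'rV[R]_m -> 'rV[R]_q) : set 'rV[R]_(m + m + p) :=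
  [set r | exists u s, gph (rnormal (Gamma g)) u /\ nonpos_orthant s /\
     r = row_mx u s].

Definition Phat n m p (phi : 'rV[R]_(n + m) -> 'rV[R]_m)
    (G : 'rV[R]_(n + m) -> 'rV[R]_p) (z : 'rV[R]_(n + m)) : 'rV[R]_(m + m + p) :=
  row_mx (row_mx (rsubmx z) (- phi z)) (G z).

Definition OmegaM n m p q (phi : 'rV[R]_(n + m) -> 'rV[R]_m)
    (G : 'rV[R]_(n + m) -> 'rV[R]_p) (g : 'rV[R]_m -> 'rV[R]_q) : set 'rV[R]_(n + m) :=
  [set z | Dhat g (Phat phi G z)].

Definition B_stationary n m p q (F : 'rV[R]_(n + m) -> R)
    (phi : 'rV[R]_(n + m) -> 'rV[R]_m) (G : 'rV[R]_(n + m) -> 'rV[R]_p)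
    (g : 'rV[R]_m -> 'rV[R]_q) (zb : 'rV[R]_(n + m)) : Prop :=
  exists2 xi, rnormal (OmegaM phi G g) zb xi & grad F zb + xi = 0.

Definition GGCQ n m p q (phi : 'rV[R]_(n + m) -> 'rV[R]_m)
    (G : 'rV[R]_(n + m) -> 'rV[R]_p) (g : 'rV[R]_m -> 'rV[R]_q)
    (zb : 'rV[R]_(n + m)) : Prop :=
  rnormal (OmegaM phi G g) zb =
  polar [set d | tangent_cone (Dhat g) (Phat phi G zb) (d *m jac (Phat phi G) zb)].

Definition Lambda_bar m q (g : 'rV[R]_m -> 'rV[R]_q) (yb ys : 'rV[R]_m) : set 'rV[R]_q :=
  [set lam | rnormal (@nonpos_orthant _) (g yb) lam /\ lam *m (jac g yb)^T = ys].

Definition hess_lag m q (g : 'rV[R]_m -> 'rV[R]_q) (lam : 'rV[R]_q) (y : 'rV[R]_m)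
  : 'M[R]_(m, m) := hess (fun y' => dotp lam (g y')) y.

Definition Lambda_bar_v m q (g : 'rV[R]_m -> 'rV[R]_q) (yb ys v : 'rV[R]_m)
  : set 'rV[R]_q :=
  [set lam | Lambda_bar g yb ys lam /\
     forall lam', Lambda_bar g yb ys lam' ->
       (v *m hess_lag g lam' yb *m v^T) ord0 ord0
         <= (v *m hess_lag g lam yb *m v^T) ord0 ord0].

End Defs.
Arguments nonpos_orthant {R k}.

(* Main.v *)
(* Let K be the critical cone and S the Hessian of the Lagrangian for the chosen
   multiplier, which solves the linear program defining the directional
   multipliers for every v in K. Only one inclusion is needed about the tangent
   cone to the graph of the normal cone mapping of Gamma: it contains all pairs
   (v, S v + z) with v in K and z in N_K(v). Such pairs are reached by minimising
   over Gamma a linear function plus a quadratic centred at yb + t v: linear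
   programming duality and metric subregularity provide feasible competitors of
   the right second order, the Lagrangian provides the matching lower bound, and
   z . u <= 0 on K forces the rescaled minimisers to converge to v.

   K being polyhedral, these pairs form, up to a shear, the graph of N_K, a finite
   union of polyhedral cones. B-stationarity makes the gradient of F nonnegative
   on the linearised feasible set, and metric subregularity turns this into an
   exact penalty bound on the graph. Quadratic penalisation gives approximate
   multipliers that are bounded regular normals to the graph; since only finitely
   many critical cones of K occur, compactness yields exact multipliers. *)
Require Import Defs.
From HB Require Import structures.
From mathcomp Require Import all_boot all_order all_algebra.
From mathcomp Require Import all_classical all_reals all_analysis.
From mathcomp Require Import ring lra.
Import Order.TTheory GRing.Theory Num.Theory.
Import numFieldNormedType.Exports.
Local Open Scope classical_set_scope.
Local Open Scope ring_scope.

Set Implicit Arguments.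
Unset Strict Implicit.
Unset Printing Implicit Defensive.

(** * Euclidean product and continuity on row vectors *)

(** Write [T] for the tangent cone of [Dhat g] and [C] for the conic subset of [T] that is
    exhibited. One inclusion suffices because stationarity and subregularity, both assumed for the
    system posed with [T], pass to [C]: for [y] in [C] the distance from [d] to the linearised
    feasible set is at most a constant times [|d A - y|]. In the auxiliary minimisation the linear
    term carries [c = v S + z]. Then the objective at [yb + t u], divided by [t ^+ 2], is bounded
    below, up to constants and small errors, by half of [(u - v) S (u - v)], plus [al / 2] times
    [|u - v| ^+ 2], minus [z . u], and a large [al] makes the quadratic part coercive. The graph of
    N_K is not convex, so Farkas' lemma cannot be applied to it as a whole. The penalised minimisers
    shrink to the origin with the tolerance, and a limit of their normals would only be a limiting
    normal there. But the pair [(v, z)] enters the wanted conditions only through its critical cone;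
    freezing one of the finitely many cones leaves conditions that are closed in the multipliers
    alone. *)

Section Dotp.
Context {R : realType}.

Lemma dotpC k (a b : 'rV[R]_k) : dotp a b = dotp b a.
Proof. by apply: eq_bigr => i _; rewrite mulrC. Qed.

Lemma dotpDl k (a b c : 'rV[R]_k) : dotp (a + b) c = dotp a c + dotp b c.
Proof. by rewrite -big_split; apply: eq_bigr => i _; rewrite mxE mulrDl. Qed.

Lemma dotpDr k (a b c : 'rV[R]_k) : dotp a (b + c) = dotp a b + dotp a c.
Proof. by rewrite dotpC dotpDl !(dotpC _ a). Qed.

Lemma dotpZl k t (a b : 'rV[R]_k) : dotp (t *: a) b = t * dotp a b.
Proof. by rewrite mulr_sumr; apply: eq_bigr => i _; rewrite mxE mulrA. Qed.

Lemma dotpZr k t (a b : 'rV[R]_k) : dotp a (t *: b) = t * dotp a b.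
Proof. by rewrite dotpC dotpZl dotpC. Qed.

Lemma dotpNl k (a b : 'rV[R]_k) : dotp (- a) b = - dotp a b.
Proof. by rewrite -scaleN1r dotpZl mulN1r. Qed.

Lemma dotpNr k (a b : 'rV[R]_k) : dotp a (- b) = - dotp a b.
Proof. by rewrite dotpC dotpNl dotpC. Qed.

Lemma dotp0l k (a : 'rV[R]_k) : dotp 0 a = 0.
Proof. by rewrite -(scale0r 0) dotpZl mul0r. Qed.

Lemma dotp0r k (a : 'rV[R]_k) : dotp a 0 = 0.
Proof. by rewrite dotpC dotp0l. Qed.

Definition dotpE := (dotpDl, dotpDr, dotpNl, dotpNr, dotpZl, dotpZr).

Lemma dotp_suml k (I : Type) (r : seq I) (P : pred I) (f : I -> 'rV[R]_k) b :
  dotp (\sum_(i <- r | P i) f i) b = \sum_(i <- r | P i) dotp (f i) b.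
Proof.
elim/big_rec2: _ => [|i x y _ <-]; first by rewrite dotp0l.
by rewrite dotpDl.
Qed.

Lemma dotpM k l (a : 'rV[R]_k) (A : 'M[R]_(k, l)) b :
  dotp (a *m A) b = dotp a (b *m A^T).
Proof.
have E i (c d : 'rV[R]_i) : dotp c d = (c *m d^T) ord0 ord0.
  by rewrite mxE; apply: eq_bigr => j _; rewrite mxE.
by rewrite !E -mulmxA trmx_mul trmxK.
Qed.

Lemma dotp_row_mx k l (a c : 'rV[R]_k) (b d : 'rV[R]_l) :
  dotp (row_mx a b) (row_mx c d) = dotp a c + dotp b d.
Proof.
rewrite /dotp big_split_ord /=; congr (_ + _); apply: eq_bigr => i _.
  by rewrite !row_mxEl.
by rewrite !row_mxEr.
Qed.

Lemma dotp_delta k (a : 'rV[R]_k) i : dotp a (delta_mx ord0 i) = a ord0 i.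
Proof.
rewrite /dotp (bigD1 i) //= mxE !eqxx mulr1 big1 ?addr0 // => j ji.
by rewrite mxE (negPf ji) andbF mulr0.
Qed.

Lemma coord_le_norm k (a : 'rV[R]_k) i : `|a ord0 i| <= `|a|.
Proof.
by rewrite [leRHS]/Num.Def.normr/= mx_normrE (le_bigmax _ _ (ord0, i)).
Qed.

Lemma norm_le_coord k (a : 'rV[R]_k) e :
  0 <= e -> (forall i, `|a ord0 i| <= e) -> `|a| <= e.
Proof.
move=> e0 H; rewrite [leLHS]/Num.Def.normr/= mx_normrE; apply: bigmax_le => // -[i j] _.
by rewrite /= ord1; apply: H.
Qed.

(** [|a|] is the maximum norm whereas distances are Euclidean; the factors equal to a dimension in
    later constants come from this bound or from [enorm_le_norm]. *)
Lemma dotp_le_norm k (a b : 'rV[R]_k) : `|dotp a b| <= k%:R * `|a| * `|b|.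
Proof.
apply: le_trans (ler_norm_sum _ _ _) _.
apply: (@le_trans _ _ (\sum_(i < k) (`|a| * `|b|))).
  by apply: ler_sum => i _; rewrite normrM ler_pM ?coord_le_norm.
by rewrite sumr_const card_ord -mulrA mulr_natl.
Qed.

Lemma dotp_ge0 k (a : 'rV[R]_k) : 0 <= dotp a a.
Proof. by apply: sumr_ge0 => i _; rewrite -expr2 sqr_ge0. Qed.

Lemma coord_le_dotp k (a : 'rV[R]_k) i : a ord0 i ^+ 2 <= dotp a a.
Proof.
rewrite /dotp (bigD1 i) //= -expr2 lerDl.
by apply: sumr_ge0 => j _; rewrite -expr2 sqr_ge0.
Qed.

Lemma norm_le_enorm k (a : 'rV[R]_k) : `|a| <= enorm a.
Proof.
apply: norm_le_coord => [|i]; first exact: sqrtr_ge0.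
by rewrite -sqrtr_sqr ler_wsqrtr// coord_le_dotp.
Qed.

Lemma enorm_sq k (a : 'rV[R]_k) : enorm a ^+ 2 = dotp a a.
Proof. by rewrite sqr_sqrtr // dotp_ge0. Qed.

Lemma enorm_ge0 k (a : 'rV[R]_k) : 0 <= enorm a.
Proof. exact: sqrtr_ge0. Qed.

Lemma norm_sq_le_dotp k (a : 'rV[R]_k) : `|a| ^+ 2 <= dotp a a.
Proof. by rewrite -enorm_sq lerXn2r ?nnegrE ?enorm_ge0 ?norm_le_enorm. Qed.

Lemma enormZ k t (a : 'rV[R]_k) : 0 <= t -> enorm (t *: a) = t * enorm a.
Proof.
move=> t0; rewrite /enorm dotpZl dotpZr mulrA sqrtrM ?mulr_ge0//.
by rewrite -expr2 sqrtr_sqr ger0_norm.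
Qed.

Lemma enormN k (a : 'rV[R]_k) : enorm (- a) = enorm a.
Proof. by rewrite /enorm dotpNl dotpNr opprK. Qed.

Lemma enorm_le_norm k (a : 'rV[R]_k) : enorm a <= k%:R * `|a|.
Proof.
have E : dotp a a <= (k%:R * `|a|) ^+ 2.
  apply: le_trans (ler_norm _) _. apply: le_trans (dotp_le_norm _ _) _.
  rewrite -mulrA -expr2 exprMn ler_wpM2r ?sqr_ge0// -natrX ler_nat.
  by case: (k) => [|i]; rewrite ?exp0n// -[X in (X <= _)%N]expn1 leq_pexp2l.
by rewrite -(@ger0_norm _ (_ * _)) ?mulr_ge0// -sqrtr_sqr ler_wsqrtr.
Qed.

Lemma dotp_self_eq0 k (a : 'rV[R]_k) : dotp a a <= 0 -> a = 0.
Proof.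
move=> H; apply/eqP; rewrite -normr_eq0 -sqrf_eq0 eq_le sqr_ge0 andbT.
exact: le_trans (norm_sq_le_dotp _) H.
Qed.

Lemma norm_mulmx_le k l (A : 'M[R]_(k, l)) :
  exists2 C, 0 < C & forall a : 'rV[R]_k, `|a *m A| <= C * `|a|.
Proof.
exists (1 + \sum_i \sum_j `|A i j|).
  by rewrite ltr_wpDr // sumr_ge0// => i _; rewrite sumr_ge0.
move=> a; apply: norm_le_coord.
  by rewrite mulr_ge0// addr_ge0// sumr_ge0// => i _; rewrite sumr_ge0.
move=> j; rewrite mxE; apply: le_trans (ler_norm_sum _ _ _) _.
rewrite mulrDl mul1r -[leLHS]add0r lerD // mulr_suml.
apply: ler_sum => i _; rewrite normrM mulrC ler_pM ?coord_le_norm//.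
by rewrite (bigD1 j)//= lerDl sumr_ge0.
Qed.

Lemma continuous_dotp (T : topologicalType) k (f h : T -> 'rV[R]_k) :
  continuous f -> continuous h -> continuous (fun x => dotp (f x) (h x)).
Proof.
move=> cf ch; apply: continuous_big => [|i _ x]; first exact: add_continuous.
apply: cvgM.
  exact: (continuous_comp (cf x) (@coord_continuous _ _ _ _ _ _)).
exact: (continuous_comp (ch x) (@coord_continuous _ _ _ _ _ _)).
Qed.

Lemma continuous_mulmx k l (A : 'M[R]_(k, l)) :
  continuous (fun a : 'rV[R]_k => a *m A).
Proof.
have [C C0 H] := norm_mulmx_le A => a.
apply/(@cvgrPdist_le _ _ _ (nbhs a) (nbhs_filter a)) => e e0.
apply/nbhs_ballP; exists (e / C) => /=; first by rewrite divr_gt0.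
move=> b; rewrite -ball_normE /= => ab.
by rewrite -mulmxBl; apply: le_trans (H _) _; rewrite -ler_pdivlMl// mulrC ltW.
Qed.

Lemma continuous_mulmxr (T : topologicalType) k l (f : T -> 'rV[R]_k)
  (A : 'M[R]_(k, l)) : continuous f -> continuous (fun x => f x *m A).
Proof.
by move=> cf x; exact: (continuous_comp (cf x) (@continuous_mulmx _ _ A _)).
Qed.

Lemma continuous_rV_sub (T : topologicalType) k (f h : T -> 'rV[R]_k) :
  continuous f -> continuous h -> continuous (fun x => f x - h x).
Proof. by move=> cf ch x; exact: (cvgB (cf x) (ch x)). Qed.

Lemma continuous_rV_id k : continuous (@id 'rV[R]_k).
Proof. by move=> x; exact: cvg_id. Qed.

Lemma continuous_rV_norm (T : topologicalType) k (f : T -> 'rV[R]_k) :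
  continuous f -> continuous (fun x => `|f x|).
Proof. by move=> cf x; exact: (cvg_norm (cf x)). Qed.

Lemma continuous_real_add (T : topologicalType) (f h : T -> R) :
  continuous f -> continuous h -> continuous (fun x => f x + h x).
Proof. by move=> cf ch x; exact: (cvgD (cf x) (ch x)). Qed.

Lemma continuous_real_scale (T : topologicalType) (f : T -> R) c :
  continuous f -> continuous (fun x => c * f x).
Proof. by move=> cf x; exact: (cvgM (@cvg_cst _ _ _ _ _) (cf x)). Qed.

End Dotp.

(** * Farkas' lemma and tangent cones *)

Section Farkas.
Context {R : realType}.

(* Bartl's induction: if [z] separates [c] from all generators but [a j], the
   problem reduces to the projections along [a j] onto the orthogonal of [z] *)
Lemma farkas_seq (J : eqType) n (s : seq J) (a : J -> 'rV[R]_n) (c : 'rV[R]_n) :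
  uniq s ->
  (forall x, (forall j, j \in s -> dotp (a j) x <= 0) -> dotp c x <= 0) ->
  exists2 y : J -> R, (forall j, 0 <= y j) & c = \sum_(j <- s) y j *: a j.
Proof.
elim: s a c => [|j0 s IH] a c /=.
  move=> _ H; exists (fun=> 0) => //; rewrite big_nil.
  by apply: dotp_self_eq0; apply: H.
move=> /andP[j0s us] H.
have [Hs|] := pselect (forall x, (forall j, j \in s -> dotp (a j) x <= 0) ->
    dotp c x <= 0).
  have [y y0 cE] := IH a c us Hs.
  exists (fun j => if j == j0 then 0 else y j) => [j|]; first by case: ifP.
  rewrite big_cons eqxx scale0r add0r cE; apply: eq_big_seq => j js.
  by case: eqP => // jj0; rewrite jj0 in js; rewrite js in j0s.
move=> /existsNP[z /not_implyP[zs /negP]]; rewrite -ltNge => cz.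
have az : 0 < dotp (a j0) z.
  rewrite ltNge; apply/negP => az; move: cz; rewrite ltNge => /negP; apply.
  by apply: H => j; rewrite inE => /orP[/eqP->//|/zs].
pose r b : 'rV[R]_n := b - (dotp b z / dotp (a j0) z) *: a j0.
have [x xs|y y0 cE] := IH (fun j => r (a j)) (r c) us.
  (* The adjoint of [r] applied to [x]. It is orthogonal to [a j0], so the constraint left out of
     the induction holds at [x'] with equality. *)
  pose x' := x - (dotp (a j0) x / dotp (a j0) z) *: z.
  have E b : dotp b x' = dotp (r b) x.
    by rewrite /x' /r !dotpE; field; rewrite gt_eqF.
  rewrite -E; apply: H => j; rewrite inE => /orP[/eqP->|js].
    by rewrite /x' !dotpE divfK ?gt_eqF// subrr.
  by rewrite E xs.
(* Projecting along [a j0] removed these multiples from [c] and from the [a j]. Their balance is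
   nonnegative, since [z] is positive on [c] and nonpositive on the [a j] with [j] in [s]. *)
pose b0 := dotp c z / dotp (a j0) z -
  \sum_(j <- s) y j * (dotp (a j) z / dotp (a j0) z).
exists (fun j => if j == j0 then b0 else y j) => [j|].
  case: ifP => // _; rewrite subr_ge0; apply: (@le_trans _ _ 0).
    rewrite big_seq; apply: sumr_le0 => k ks; apply: mulr_ge0_le0 => //.
    by apply: mulr_le0_ge0; [exact: zs|rewrite invr_ge0 ltW].
  by rewrite ltW// divr_gt0.
rewrite big_cons eqxx; under eq_big_seq => j js.
  rewrite ifN; last by apply: contra j0s => /eqP<-.
  over.
move: cE; rewrite {1}/r => /eqP; rewrite subr_eq => /eqP cE; rewrite [LHS]cE.
rewrite (eq_bigr (fun j => y j *: a j -
    (y j * (dotp (a j) z / dotp (a j0) z)) *: a j0)) => [|j _]; last first.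
  by rewrite scalerBr scalerA.
by rewrite sumrB -scaler_suml /b0 scalerBl addrAC [X in X - _]addrC addrAC.
Qed.

Lemma farkas (J : finType) n (a : J -> 'rV[R]_n) (c : 'rV[R]_n) :
  (forall x, (forall j, dotp (a j) x <= 0) -> dotp c x <= 0) ->
  exists2 y : J -> R, (forall j, 0 <= y j) & c = \sum_j y j *: a j.
Proof.
move=> H; have [|x xs|y y0 cE] := @farkas_seq J n (index_enum J) a c.
- exact: index_enum_uniq.
- by apply: H => j; apply: xs; rewrite mem_index_enum.
- by exists y.
Qed.

End Farkas.

Section TangentCone.
Context {R : realType} {n : nat}.
Implicit Types (Om : set 'rV[R]_n) (x w : 'rV[R]_n).

(** One radius for both the step and the direction hides the sequences of the definition; countable
    choice with radii [1 / (k + 1)] brings them back. *)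
Lemma tangent_coneP Om x w : tangent_cone Om x w <->
  forall e, 0 < e -> exists t w', [/\ 0 < t, t < e, `|w' - w| < e & Om (x + t *: w')].
Proof.
split.
  move=> [t [wk [t0 [/cvgrPdist_lt tc [/cvgrPdist_lt wc H]]]]] e e0.
  have [k [kt kw]] : exists k, `|0 - t k| < e /\ `|w - wk k| < e.
    have [N _ HN] : \forall k \near \oo, `|0 - t k| < e /\ `|w - wk k| < e.
      by near=> k; split; near: k; [exact: tc|exact: wc].
    by exists N; apply: HN => /=.
  exists (t k), (wk k); split=> //; last by rewrite distrC.
  by move: kt; rewrite sub0r normrN gtr0_norm.
move=> H; have /choice[f Hf] : forall k : nat, exists p : R * 'rV[R]_n,
    [/\ 0 < p.1, p.1 < k.+1%:R^-1, `|p.2 - w| < k.+1%:R^-1 & Om (x + p.1 *: p.2)].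
  move=> k; have [|t [w' ?]] := H k.+1%:R^-1; first by rewrite invr_gt0.
  by exists (t, w').
exists (fun k => (f k).1), (fun k => (f k).2); split.
  by move=> k; have [] := Hf k.
split.
  apply/cvgrPdist_lt => e e0; near=> k.
  have [h1 h2 _ _] := Hf k; rewrite sub0r normrN gtr0_norm//.
  by apply: lt_trans h2 _; near: k; exact: near_infty_natSinv_lt (PosNum e0).
split; last by move=> k; have [] := Hf k.
apply/cvgrPdist_lt => e e0; near=> k.
have [_ _ h2 _] := Hf k; rewrite distrC.
by apply: lt_trans h2 _; near: k; exact: near_infty_natSinv_lt (PosNum e0).
Unshelve. all: by end_near. Qed.

Lemma tangent_cone_ray Om x w e :
  0 < e -> (forall t, 0 < t -> t < e -> Om (x + t *: w)) -> tangent_cone Om x w.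
Proof.
move=> e0 H; apply/tangent_coneP => d d0.
have m0 : 0 < Num.min d e by rewrite lt_min d0.
exists (Num.min d e / 2), w; rewrite subrr normr0; split=> //.
- by rewrite divr_gt0.
- have : Num.min d e <= d by rewrite ge_min lexx.
  lra.
- apply: H; first by rewrite divr_gt0.
  have : Num.min d e <= e by rewrite ge_min lexx orbT.
  lra.
Qed.

Lemma tangent_halfspace Om b x w : (forall u, Om u -> dotp b u <= 0) ->
  dotp b x = 0 -> tangent_cone Om x w -> dotp b w <= 0.
Proof.
move=> bOm bx /tangent_coneP Tw; apply/ler_addgt0Pr => e e0; rewrite add0r.
pose C := n%:R * `|b| + 1; have C0 : 0 < C by rewrite ltr_wpDl// mulr_ge0.
have [t [w' [t0 _ ww' /bOm]]] := Tw (e / C) (divr_gt0 e0 C0).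
rewrite dotpDr (dotpZr t) bx add0r pmulr_rle0// => w'0.
have h1 : dotp b (w - w') <= n%:R * `|b| * (e / C).
  apply: le_trans (ler_norm _) _; apply: le_trans (dotp_le_norm _ _) _.
  by rewrite ler_wpM2l ?mulr_ge0// distrC ltW.
have h2 : n%:R * `|b| * (e / C) <= e.
  have -> : n%:R * `|b| * (e / C) = e * ((C - 1) / C).
    by rewrite {2}/C addrK; field; rewrite gt_eqF.
  by rewrite ler_piMr ?(ltW e0)// ler_pdivrMr// mul1r gerBl.
rewrite dotpDr dotpNr in h1; lra.
Qed.

(** Fermat's rule: [b + a *: (x - p)] is the gradient at [x] of the quadratic being minimised. The
    same rule yields the normals to [Gamma g] and, with [b = 0], those to the penalised cone. *)
Lemma polar_tangent_of_min Om (b p : 'rV[R]_n) (a d : R) x :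
  0 <= a -> 0 < d ->
  (forall x', `|x' - x| < d -> Om x' ->
    dotp b x + a / 2 * dotp (x - p) (x - p) <=
    dotp b x' + a / 2 * dotp (x' - p) (x' - p)) ->
  polar (tangent_cone Om x) (- (b + a *: (x - p))).
Proof.
move=> a0 d0 H w /tangent_coneP Tw; set G := b + _.
apply/ler_addgt0Pr => e e0; rewrite add0r.
pose M := `|w| + 1; have M0 : 0 < M by rewrite ltr_wpDl.
pose K := a * (n%:R * M ^+ 2) + n%:R * `|G| + 1.
have K0 : 0 < K.
  rewrite /K ltr_wpDl// addr_ge0// !mulr_ge0//; exact/ltW.
pose r := Num.min (Num.min 1 (d / M)) (e / K).
have r0 : 0 < r by rewrite !lt_min ltr01 !divr_gt0.
have [t [w' [t0 tr wr Ow]]] := Tw r r0.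
have r1 : r <= 1 by rewrite !ge_min lexx.
have rd : r <= d / M by rewrite !ge_min lexx !orbT.
have re : r <= e / K by rewrite !ge_min lexx !orbT.
have w'M : `|w'| <= M.
  rewrite -[w'](subrK w); apply: le_trans (ler_normD _ _) _.
  by rewrite addrC lerD2l; apply: ltW; apply: lt_le_trans wr _.
have tM : t * M < d by rewrite -ltr_pdivlMr//; apply: lt_le_trans rd.
have := H (x + t *: w'); rewrite [x + _ - x]addrC addKr normrZ gtr0_norm//.
move=> /(_ (le_lt_trans (ler_wpM2l (ltW t0) w'M) tM) Ow); rewrite -subr_ge0 => H1.
have {}H1 : 0 <= dotp G w' + t * a / 2 * dotp w' w'.
  rewrite -(pmulr_rge0 _ t0); apply: le_trans H1 _.
  rewrite /G !dotpE (dotpC w' x) (dotpC w' p) (dotpC p x).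
  by rewrite le_eqVlt; apply/orP; left; apply/eqP; field.
have E1 : `|dotp G (w' - w)| <= n%:R * `|G| * r.
  apply: le_trans (dotp_le_norm _ _) _.
  by rewrite ler_wpM2l ?mulr_ge0// ltW.
have E2 : dotp w' w' <= n%:R * M ^+ 2.
  apply: le_trans (ler_norm _) _; apply: le_trans (dotp_le_norm _ _) _.
  by rewrite -mulrA ler_wpM2l// expr2 ler_pM.
have E3 : t * a / 2 * dotp w' w' <= r * (a * (n%:R * M ^+ 2)).
  have rt : 0 <= r - t by rewrite subr_ge0 ltW.
  have q0 := dotp_ge0 w'.
  have h1 := mulr_ge0 (mulr_ge0 rt a0) q0.
  have h2 := mulr_ge0 (mulr_ge0 (ltW t0) a0) q0.
  have h3 : 0 <= r * a * (n%:R * M ^+ 2 - dotp w' w').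
    by rewrite !mulr_ge0 ?(ltW r0)// subr_ge0.
  lra.
have E4 : r * K <= e by rewrite -ler_pdivlMr.
have E5 := ler_norm (dotp G (w' - w)); have E6 := ltW r0.
have E7 : - dotp G w = dotp G (w' - w) - dotp G w' by rewrite !dotpE; ring.
move: E4; rewrite dotpNl E7 /K => E4; lra.
Qed.

End TangentCone.

(** * First- and second-order expansions *)

Section Differential.
Context {R : realType}.

Lemma differentiable_approx (V W : normedModType R) (f : V -> W) z :
  differentiable f z -> forall e, 0 < e -> exists2 d, 0 < d &
    forall h, `|h| < d -> `|f (z + h) - f z - 'd f z h| <= e * `|h|.
Proof.
move=> /diff_locally /eqaddoP H e e0.
have /nbhs_ballP[d /= d0 Hd] := H e e0; exists d => // h hd.
have := Hd h; rewrite -ball_normE /= sub0r normrN => /(_ hd).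
by rewrite [z + h]addrC -addrA -opprD.
Qed.

Lemma differential_approx (V W : normedModType R) (f : V -> W)
    (df : {linear V -> W}) z :
  continuous df ->
  (forall e, 0 < e -> exists2 d, 0 < d &
    forall h, `|h| < d -> `|f (z + h) - f z - df h| <= e * `|h|) ->
  differentiable f z /\ 'd f z = df :> (V -> W).
Proof.
move=> cdf H.
have E : f \o shift z = cst (f z) + df +o_ 0 id.
  apply/eqaddoP => e e0; have [d d0 Hd] := H e e0.
  apply/nbhs_ballP; exists d => //= h; rewrite -ball_normE /= sub0r normrN => hd.
  by have := Hd h hd; rewrite [z + h]addrC -addrA -opprD.
have D := diff_unique cdf E; split=> //.
by apply/diff_locallyP; rewrite D.
Qed.

Lemma diff_grad k (f : 'rV[R]_k -> R) z h : 'd f z h = dotp (grad f z) h.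
Proof.
rewrite {1}[h]row_sum_delta linear_sum; apply: eq_bigr => i _.
by rewrite linearZ mxE mulrC.
Qed.

Lemma diff_jac k l (f : 'rV[R]_k -> 'rV[R]_l) z h : 'd f z h = h *m jac f z.
Proof.
rewrite {1}[h]row_sum_delta linear_sum; apply/rowP => j.
rewrite summxE mxE; apply: eq_bigr => i _.
by rewrite linearZ !mxE.
Qed.

Lemma jac_approx k l (f : 'rV[R]_k -> 'rV[R]_l) z (J : 'M[R]_(k, l)) :
  (forall e, 0 < e -> exists2 d, 0 < d &
    forall h, `|h| < d -> `|f (z + h) - f z - h *m J| <= e * `|h|) ->
  differentiable f z /\ jac f z = J.
Proof.
move=> H; have [|//|D E] := @differential_approx _ _ f (mulmxr J) z.
  exact: continuous_mulmx.
split=> //; apply/matrixP => i j; rewrite mxE E /=.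
by rewrite -rowE mxE.
Qed.

Lemma grad_approx k (f : 'rV[R]_k -> R) z (b : 'rV[R]_k) :
  (forall e, 0 < e -> exists2 d, 0 < d &
    forall h, `|h| < d -> `|f (z + h) - f z - dotp b h| <= e * `|h|) ->
  differentiable f z /\ grad f z = b.
Proof.
have lin : linear (dotp b) by move=> t x y; rewrite dotpDr dotpZr.
pose dL := GRing.isLinear.Build _ _ _ _ _ lin.
pose L : {linear 'rV[R]_k -> R} := HB.pack (dotp b) dL.
move=> H; have [||D E] := @differential_approx _ _ f L z.
- apply: (@continuous_dotp _ 'rV[R]_k k (cst b) id).
    exact: cst_continuous.
  by move=> x; exact: cvg_id.
- exact: H.
split=> //; apply/rowP => i; rewrite mxE E /=.
exact: dotp_delta.
Qed.

Lemma differentiable_entry k l (f : 'rV[R]_k -> 'rV[R]_l) z j :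
  differentiable f z ->
  differentiable (fun x => f x ord0 j) z /\
  grad (fun x => f x ord0 j) z = \row_i jac f z i j.
Proof.
move=> D; apply: grad_approx => e e0; have [d d0 H] := differentiable_approx D e0.
exists d => // h /H; apply: le_trans; rewrite diff_jac.
apply: le_trans (coord_le_norm _ j); rewrite !mxE.
rewrite le_eqVlt; apply/orP; left; apply/eqP; congr (`|_ - _|).
by apply: eq_bigr => i _; rewrite mxE mulrC.
Qed.

Lemma grad_entryE k l (f : 'rV[R]_k -> 'rV[R]_l) z j h :
  differentiable f z ->
  dotp (grad (fun x => f x ord0 j) z) h = (h *m jac f z) ord0 j.
Proof.
move=> /(@differentiable_entry _ _ _ _ j)[_ ->]; rewrite mxE.
by apply: eq_bigr => i _; rewrite mxE mulrC.
Qed.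

Lemma jac_sum k l (J : finType) (f : J -> 'rV[R]_k -> 'rV[R]_l) (c : J -> R) z :
  (forall j, differentiable (f j) z) ->
  jac (fun x => \sum_j c j *: f j x) z = \sum_j c j *: jac (f j) z.
Proof.
move=> D; apply: (jac_approx _).2 => e e0.
pose K := \sum_j `|c j| + 1.
have K0 : 0 < K by rewrite ltr_wpDl// sumr_ge0.
have eK : 0 < e / K by rewrite divr_gt0.
have /choice[d Hd] : forall j, exists d, 0 < d /\ forall h, `|h| < d ->
    `|f j (z + h) - f j z - h *m jac (f j) z| <= e / K * `|h|.
  move=> j; have [d d0 H] := differentiable_approx (D j) eK.
  by exists d; split=> // h /H; rewrite diff_jac.
exists (\big[Num.min/1]_j d j).
  by apply: lt_bigmin => // j _; case: (Hd j).
move=> h hd; have -> : \sum_j c j *: f j (z + h) - \sum_j c j *: f j z -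
    h *m (\sum_j c j *: jac (f j) z) =
    \sum_j c j *: (f j (z + h) - f j z - h *m jac (f j) z).
  rewrite mulmx_sumr -!sumrB; apply: eq_bigr => j _.
  by rewrite -scalemxAr !scalerBr.
apply: le_trans (ler_norm_sum _ _ _) _.
apply: (@le_trans _ _ (\sum_j `|c j| * (e / K * `|h|))).
  apply: ler_sum => j _; rewrite normrZ ler_wpM2l//; apply: (Hd j).2.
  by apply: lt_le_trans hd _; exact: bigmin_le.
rewrite -mulr_suml mulrA ler_wpM2r// mulrC mulrAC ler_pdivrMr// ler_wpM2l ?ltW//.
by rewrite /K ltrDl.
Qed.

Lemma grad_dotp k l (g : 'rV[R]_k -> 'rV[R]_l) (c : 'rV[R]_l) z :
  differentiable g z ->
  grad (fun x => dotp c (g x)) z =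
    \sum_j c ord0 j *: grad (fun x => g x ord0 j) z.
Proof.
move=> D; apply: (grad_approx _).2 => e e0.
pose K := l%:R * `|c| + 1; have K0 : 0 < K by rewrite ltr_wpDl// mulr_ge0.
have eK : 0 < e / K by rewrite divr_gt0.
have [d d0 Hd] := differentiable_approx D eK; exists d => // h hd.
have -> : dotp c (g (z + h)) - dotp c (g z) -
    dotp (\sum_j c ord0 j *: grad (fun x => g x ord0 j) z) h =
    dotp c (g (z + h) - g z - 'd g z h).
  rewrite !dotpE dotp_suml; congr (_ - _); apply: eq_bigr => j _.
  by rewrite dotpZl grad_entryE// diff_jac.
apply: le_trans (dotp_le_norm _ _) _.
apply: (@le_trans _ _ (l%:R * `|c| * (e / K * `|h|))).
  by rewrite ler_wpM2l ?mulr_ge0// Hd.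
rewrite mulrA ler_wpM2r// mulrCA ger_pMr// ler_pdivrMr// mul1r /K.
by rewrite lerDl.
Qed.

Lemma hess_lag_sum m q (g : 'rV[R]_m -> 'rV[R]_q) (lam : 'rV[R]_q) y :
  C2 g ->
  hess_lag g lam y = \sum_j lam ord0 j *: hess (fun x => g x ord0 j) y.
Proof.
move=> [[Dg _] C2g]; rewrite /hess_lag /hess.
have -> : grad (fun x => dotp lam (g x)) =
    fun x => \sum_j lam ord0 j *: grad (fun x => g x ord0 j) x.
  by apply/funext => x; exact: grad_dotp.
by apply: jac_sum => j; case: (C2g j) => [D _]; exact: D.
Qed.

Lemma is_derive_line k (f : 'rV[R]_k -> R) (y h : 'rV[R]_k) (s : R) :
  (forall x : 'rV[R]_k, differentiable f x) ->
  is_derive s (1 : R) (fun s => f (y + s *: h)) (dotp (grad f (y + s *: h)) h).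
Proof.
move=> Df; pose gam : R -> 'rV[R]_k := fun s => y + s *: h.
have D1 : is_diff s gam ( *:%R^~ h).
  have -> : gam = (cst y + *:%R^~ h) by [].
  rewrite -[X in is_diff _ _ X]add0r.
  exact: (is_diffD (is_diff_cst y s) (is_diff_scalel s h)).
have D2 : differentiable (f \o gam) s.
  by apply: differentiable_comp => //; exact (Df (gam s)).
rewrite -[X in is_derive _ _ X]/(f \o gam).
apply: DeriveDef; first exact: diff_derivable.
rewrite deriveE// diff_comp//; try exact (Df (gam s)).
by rewrite /= diff_val scale1r diff_grad.
Qed.

(** The comparison function [phi] is left free: a quadratic gives the second-order expansion,
    another restriction of [f] to a line gives the second difference in [hess_sym]. *)
Lemma mean_value_line k (f : 'rV[R]_k -> R) (y h : 'rV[R]_k) (phi dphi : R -> R) :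
  (forall x : 'rV[R]_k, differentiable f x) ->
  (forall s : R, is_derive s (1 : R) phi (dphi s)) ->
  exists s, [/\ 0 <= s, s <= 1 &
    (f (y + h) - phi 1) - (f y - phi 0) = dotp (grad f (y + s *: h)) h - dphi s].
Proof.
move=> Df Dphi; pose psi := fun s => f (y + s *: h).
have D (s : R) : is_derive s (1 : R) (psi - phi)
    (dotp (grad f (y + s *: h)) h - dphi s).
  by apply: is_deriveB; exact: is_derive_line.
have C : {within `[0, 1], continuous (psi - phi)}.
  apply: continuous_subspaceT => x.
  by apply: differentiable_continuous; apply/derivable1_diffP; case: (D x).
have [s] := MVT ltr01 (fun x _ => D x) C.
rewrite in_itv/= => /andP[s0 s1]; rewrite subr0 mulr1 => E.
exists s; split; rewrite ?ltW// -E /GRing.opp/= /GRing.add/= /psi.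
by rewrite scale1r scale0r addr0.
Qed.

Lemma is_derive_quadratic (a b s : R) :
  is_derive s (1 : R) (fun s => a * s + 2^-1 * b * s ^+ 2) (a + s * b).
Proof.
have D1 := is_deriveZ a (is_derive_id s (1 : R)).
have D2 := is_deriveZ (2^-1 * b) (is_deriveX 2 (is_derive_id s (1 : R))).
have := is_deriveD D1 D2.
have E : 2^-1 * b * (2 * s) = s * b by field.
by rewrite /GRing.scale/= !mulr1 expr1 E.
Qed.

(** Subtracting the quadratic model along the segment turns the remainder into the error of the
    first-order expansion of [grad f] at [y]. *)
Lemma taylor2 k (f : 'rV[R]_k -> R) (y : 'rV[R]_k) :
  (forall x : 'rV[R]_k, differentiable f x) -> differentiable (grad f) y ->
  forall e, 0 < e -> exists2 d, 0 < d & forall h, `|h| < d ->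
    `|f (y + h) - f y - dotp (grad f y) h - 2^-1 * dotp (h *m hess f y) h|
      <= e * `|h| ^+ 2.
Proof.
move=> Df Dg e e0; pose K : R := k%:R + 1.
have K0 : 0 < K by rewrite ltr_wpDl.
have [d d0 Hd] := differentiable_approx Dg (divr_gt0 e0 K0).
exists d => // h hd; pose a := dotp (grad f y) h; pose b := dotp (h *m hess f y) h.
pose phi : R -> R := fun s => a * s + 2^-1 * b * s ^+ 2.
have Dphi (s : R) := is_derive_quadratic a b s.
have [s [s0 s1]] := @mean_value_line _ f y h phi _ Df Dphi.
rewrite /phi expr0n expr1n !mulr0 !mulr1 addr0 subr0 => E.
have -> : f (y + h) - f y - dotp (grad f y) h - 2^-1 * dotp (h *m hess f y) h =
    f (y + h) - (a + 2^-1 * b) - f y by rewrite -/a -/b; ring.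
have key (G : 'rV[R]_k) : dotp G h - (a + s * b) =
    dotp (G - grad f y - (s *: h) *m hess f y) h.
  by rewrite -scalemxAl !(dotpDl, dotpNl) (dotpZl s) /a /b; ring.
rewrite E key.
have shd : `|s *: h| <= `|h| by rewrite normrZ ger0_norm// ler_piMl.
apply: le_trans (dotp_le_norm _ _) _.
rewrite -diff_jac; have := Hd _ (le_lt_trans shd hd) => E1.
apply: (@le_trans _ _ (k%:R * (e / K * `|h|) * `|h|)).
  apply: ler_wpM2r => //; apply: ler_wpM2l => //; apply: le_trans E1 _.
  by rewrite ler_wpM2l// divr_ge0// ltW.
rewrite expr2 !mulrA ler_wpM2r// ler_wpM2r// ler_pdivrMr// mulrC.
by rewrite ler_wpM2l ?(ltW e0)// /K lerDl.
Qed.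

(** The second difference [f (y + a + b) - f (y + b) - f (y + a) + f y] is symmetric in [a] and [b],
    and the Hessian form approximates it in either order. Taking multiples [t] of [u] and [v] and
    dividing by [t ^+ 2] leaves an arbitrarily small gap. *)
Lemma hess_sym k (f : 'rV[R]_k -> R) (y : 'rV[R]_k) :
  (forall x : 'rV[R]_k, differentiable f x) -> differentiable (grad f) y ->
  (hess f y)^T = hess f y.
Proof.
move=> Df Dg.
suff S u v : dotp (v *m hess f y) u = dotp (u *m hess f y) v.
  apply/matrixP => i j; rewrite mxE.
  have := S (delta_mx ord0 i) (delta_mx ord0 j).
  by rewrite !dotp_delta -!rowE !mxE.
apply/eqP; rewrite -subr_eq0 -normr_le0; apply/ler_addgt0Pr => e e0; rewrite add0r.
pose M := `|u| + `|v|; have M0 : 0 <= M by rewrite addr_ge0.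
pose K : R := 4 * k%:R * M ^+ 2 + 1.
have K0 : 0 < K by rewrite ltr_wpDl// !mulr_ge0.
have [d d0 Hd] := differentiable_approx Dg (divr_gt0 e0 K0).
(* Mean value theorem in direction [b] for the difference of [f] along two parallel lines; both
   gradients are expanded at [y], hence the factor 2. *)
have main a b : `|a| + `|b| < d ->
    `|(f (y + a + b) - f (y + b)) - (f (y + a) - f y) - dotp (a *m hess f y) b|
      <= 2 * k%:R * (e / K) * (`|a| + `|b|) ^+ 2.
  move=> abd.
  have [s [s0 s1]] := @mean_value_line _ f (y + a) b (fun s => f (y + s *: b))
    (fun s => dotp (grad f (y + s *: b)) b) Df (fun s => is_derive_line y b s Df).
  have key (G1 G2 G0 : 'rV[R]_k) :
      dotp G1 b - dotp G2 b - dotp (a *m hess f y) b =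
      dotp (G1 - G0 - (a + s *: b) *m hess f y -
        (G2 - G0 - (s *: b) *m hess f y)) b.
    by rewrite mulmxDl !(dotpDl, dotpNl); ring.
  rewrite scale1r scale0r addr0 => ->; rewrite (key _ _ (grad f y)) => {key}.
  have sb : `|s *: b| <= `|b| by rewrite normrZ ger0_norm// ler_piMl.
  have sab : `|a + s *: b| <= `|a| + `|b|.
    by apply: le_trans (ler_normD _ _) _; rewrite lerD2l.
  have E1 := Hd _ (le_lt_trans sab abd).
  have E2 : `|s *: b| < d.
    by apply: le_lt_trans sb (le_lt_trans _ abd); rewrite lerDr.
  have {E2} := Hd _ E2; move: E1; rewrite !diff_jac addrA.
  set X := (X in `|X| <= _ -> _) => E1; set Y := (X in `|X| <= _ -> _) => E2.
  apply: le_trans (dotp_le_norm _ _) _.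
  apply: (@le_trans _ _ (k%:R * (2 * (e / K * (`|a| + `|b|))) * (`|a| + `|b|))).
    apply: ler_pM; rewrite ?mulr_ge0 ?lerDr//.
    apply: ler_wpM2l => //; apply: le_trans (ler_normB _ _) _.
    have eK : 0 <= e / K by rewrite divr_ge0 ?ltW.
    have := ler_wpM2l eK sab; have := ler_wpM2l eK sb.
    have := mulr_ge0 eK (normr_ge0 a); lra.
  by rewrite le_eqVlt; apply/orP; left; apply/eqP; ring.
have [t t0 tM] : exists2 t, 0 < t & t * M < d.
  exists (d / (M + 1)); first by rewrite divr_gt0 ?ltr_wpDl.
  by rewrite mulrAC ltr_pdivrMr ?ltr_wpDl// ltr_pM2l// ltrDl.
have tn (w : 'rV[R]_k) : `|t *: w| = t * `|w| by rewrite normrZ gtr0_norm.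
have := main (t *: v) (t *: u); have := main (t *: u) (t *: v).
rewrite !tn -!mulrDr -/M [`|v| + _]addrC -/M => /(_ tM) E1 /(_ tM).
rewrite -!addrA [t *: u + _]addrC !addrA in E1 *.
rewrite -!scalemxAl !dotpZl !dotpZr in E1 * => E2.
set A := dotp (v *m _) u in E2 *; set B := dotp (u *m _) v in E1 *.
have E3 : t ^+ 2 * `|A - B| <= t ^+ 2 * (4 * k%:R * (e / K) * M ^+ 2).
  rewrite -[t ^+ 2 in leLHS]ger0_norm ?sqr_ge0// -normrM.
  move: E1 E2; rewrite !ler_norml => /andP[E1 E1'] /andP[E2 E2'].
  apply/andP; split; move: E1 E1' E2 E2'; rewrite !expr2; lra.
rewrite ler_pM2l ?exprn_gt0// in E3; apply: le_trans E3 _.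
have -> : 4 * k%:R * (e / K) * M ^+ 2 = e * ((K - 1) / K).
  by rewrite {2}/K addrK; field; rewrite gt_eqF.
by rewrite ler_piMr ?(ltW e0)// ler_pdivrMr// mul1r gerBl.
Qed.

End Differential.

(** * Tangents to the graph of the normal cone mapping *)

Section Subregularity.
Context {R : realType}.

(** The distance in the definition is an infimum that need not be attained, hence the additive slack
    [e]. *)
Lemma subregular_approx a b (M : 'rV[R]_a -> set 'rV[R]_b) zb wb :
  metric_subregular M zb wb ->
  exists kappa d, [/\ 0 < kappa, 0 < d & forall z w e, `|z - zb| < d -> M z w ->
    0 < e -> exists2 z', M z' wb & enorm (z - z') < kappa * enorm (wb - w) + e].
Proof.
move=> [_ [W [kappa [/nbhs_ballP[d /= d0 Wd] [k0 H]]]]].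
exists kappa, d; split=> // z w e zd Mzw e0.
have Wz : W z by apply: Wd; rewrite -ball_normE /= distrC.
have : (dist_set z [set z' | M z' wb] < (kappa * enorm (wb - w) + e)%:E)%E.
  apply: le_lt_trans (H z Wz) _.
  apply: (@le_lt_trans _ _ (kappa%:E * (enorm (wb - w))%:E)%E).
    rewrite lee_pmul2l ?lte_fin//; apply: ereal_inf_lbound.
    by exists w.
  by rewrite -EFinM lte_fin ltrDl.
move=> /ereal_inf_lt[_ [z' Mz' <-]]; rewrite lte_fin => lt.
by exists z'.
Qed.

Lemma feasible_approx m q (g : 'rV[R]_m -> 'rV[R]_q) yb :
  metric_subregular (fun y => [set g y - s | s in nonpos_orthant]) yb 0 ->
  exists kappa d, [/\ 0 < kappa, 0 < d & forall y e, `|y - yb| < d -> 0 < e ->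
    (forall i, g y ord0 i <= e) -> exists2 y', Gamma g y' & `|y - y'| <= kappa * e].
Proof.
move=> /subregular_approx[kappa [d [k0 d0 H]]].
exists (kappa * q%:R + 1), d; split=> //; first by rewrite ltr_wpDl// mulr_ge0// ltW.
move=> y e yd e0 ye.
(* The projection of [g y] onto the orthant, so that [g y - s] is the positive part of [g y], with
   entries at most [e]. In the constant, [q] pays for the Euclidean norm and 1 for the slack of the
   infimum. *)
pose s : 'rV[R]_q := \row_i Num.min (g y ord0 i) 0.
have [|y' [s' s'0 /eqP]] := H y (g y - s) e yd _ e0.
  by exists s => // i; rewrite mxE ge_min lexx orbT.
rewrite subr_eq0 => /eqP gs' lt; exists y'; first by rewrite /Gamma/= gs'.
apply: le_trans (norm_le_enorm _) _; apply: le_trans (ltW lt) _.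
rewrite mulrDl mul1r lerD2r sub0r enormN -mulrA ler_wpM2l ?(ltW k0)//.
apply: le_trans (enorm_le_norm _) _; rewrite ler_wpM2l//.
apply: norm_le_coord => [|i]; first exact: ltW.
rewrite !mxE /Num.min; case: ifP => h; first by rewrite subrr normr0 ltW.
by rewrite subr0 ger0_norm// leNgt h.
Qed.

End Subregularity.

Lemma uniform_radius (R : realType) (J : finType) (P : J -> R -> Prop) :
  (forall j d d', 0 < d' -> d' <= d -> P j d -> P j d') ->
  (forall j, exists2 d, 0 < d & P j d) -> exists2 d, 0 < d & forall j, P j d.
Proof.
move=> mono H; have /choice[d Hd] : forall j, exists d, 0 < d /\ P j d.
  by move=> j; have [d] := H j; exists d.
have D0 : 0 < \big[Num.min/1]_j d j by apply: lt_bigmin => // j _; case: (Hd j).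
exists (\big[Num.min/1]_j d j) => // j.
by apply: mono (Hd j).2 => //; exact: bigmin_le.
Qed.

Lemma exists_min (R : realType) n (f : 'rV[R]_n -> R) (A : set 'rV[R]_n) M :
  A !=set0 -> closed A -> (forall x, A x -> `|x| <= M) -> continuous f ->
  exists2 x, A x & forall y, A y -> f x <= f y.
Proof.
move=> A0 cA bA cf; have kA : compact A.
  apply: bounded_closed_compact => //; exists M; split; first exact: num_real.
  by move=> x Mx y /bA /le_trans; apply; exact: ltW.
have [c cA' H] := EVT_min_rV A0 kA (continuous_subspaceT cf).
by exists c => [|y Ay]; [exact/set_mem|apply: H; exact/mem_set].
Qed.

Lemma closed_Gamma (R : realType) m q (g : 'rV[R]_m -> 'rV[R]_q) :
  continuous g -> closed (Gamma g).
Proof.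
move=> cg; rewrite /Gamma /nonpos_orthant.
have -> : [set y | [set s : 'rV[R]_q | forall i, s ord0 i <= 0] (g y)] =
    \bigcap_(i in setT) ((fun y => g y ord0 i) @^-1` [set x : R | x <= 0]).
  by apply/seteqP; split=> y /= H i; [move=> _|]; apply: H.
apply: closed_bigI => i _; apply: closed_comp; last exact: closed_le.
move=> y _; exact: (continuous_comp (cg y) (@coord_continuous _ _ _ _ _ _)).
Qed.

(** * Feasible arcs and normals of [Gamma g] near the base point *)

Section SecondOrder.
Context {R : realType} {m q : nat}.
Variables (g : 'rV[R]_m -> 'rV[R]_q) (yb : 'rV[R]_m).
Variables (a : 'I_q -> 'rV[R]_m) (H : 'I_q -> 'M[R]_m).
Hypothesis Gyb : Gamma g yb.
Hypothesis feas : exists kappa d, [/\ 0 < kappa, 0 < d &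
  forall y e, `|y - yb| < d -> 0 < e ->
    (forall i, g y ord0 i <= e) -> exists2 y', Gamma g y' & `|y - y'| <= kappa * e].
Hypothesis approx1 : forall i e, 0 < e -> exists2 d, 0 < d & forall h, `|h| < d ->
  `|g (yb + h) ord0 i - g yb ord0 i - dotp (a i) h| <= e * `|h|.
Hypothesis approx2 : forall i e, 0 < e -> exists2 d, 0 < d & forall h, `|h| < d ->
  `|g (yb + h) ord0 i - g yb ord0 i - dotp (a i) h - 2^-1 * dotp (h *m H i) h|
    <= e * `|h| ^+ 2.

Let active i := g yb ord0 i == 0.

Lemma tangent_active_le0 w i :
  tangent_cone (Gamma g) yb w -> active i -> dotp (a i) w <= 0.
Proof.
move=> /tangent_coneP Tw /eqP ai; apply/ler_addgt0Pr => e e0; rewrite add0r.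
pose M := `|w| + 1; have M0 : 0 < M by rewrite ltr_wpDl.
pose K := M + m%:R * `|a i|; have K0 : 0 < K by rewrite ltr_wpDr// mulr_ge0.
have eK : 0 < e / K by rewrite divr_gt0.
have [d d0 Hd] := approx1 i eK.
pose r := Num.min (Num.min 1 (d / M)) (e / K).
have r0 : 0 < r by rewrite !lt_min ltr01 eK divr_gt0.
have [t [w' [t0 tr wr Ow]]] := Tw r r0.
have r1 : r <= 1 by rewrite !ge_min lexx.
have rd : r <= d / M by rewrite !ge_min lexx !orbT.
have re : r <= e / K by rewrite !ge_min lexx !orbT.
have w'M : `|w'| <= M.
  rewrite -[w'](subrK w); apply: le_trans (ler_normD _ _) _.
  by rewrite addrC lerD2l; apply: ltW; apply: lt_le_trans wr _.
have tw : `|t *: w'| = t * `|w'| by rewrite normrZ gtr0_norm.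
have tM : `|t *: w'| < d.
  rewrite tw; apply: (le_lt_trans (ler_wpM2l (ltW t0) w'M)).
  by rewrite -ltr_pdivlMr//; apply: lt_le_trans rd.
have := Hd _ tM; rewrite ai subr0 tw dotpZr ler_norml => /andP[E1 _].
have E2 : g (yb + t *: w') ord0 i <= 0 := Ow i.
have E3 : dotp (a i) w' <= e / K * M.
  have : t * dotp (a i) w' <= t * (e / K * `|w'|) by lra.
  rewrite ler_pM2l// => E3; apply: le_trans E3 _.
  by rewrite ler_wpM2l// ltW.
have E4 : dotp (a i) (w - w') <= m%:R * `|a i| * (e / K).
  apply: le_trans (ler_norm _) _; apply: le_trans (dotp_le_norm _ _) _.
  rewrite ler_wpM2l ?mulr_ge0// distrC; apply: ltW; exact: lt_le_trans wr re.
have : dotp (a i) w <= K * (e / K).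
  by rewrite -[w](subrK w') dotpDr /K mulrDl [M * _]mulrC; lra.
by rewrite mulrCA divff ?gt_eqF// mulr1.
Qed.

(** For [w] in the linearised cone, [yb + t *: w] violates the constraints by at most [eta * t], and
    the error bound moves it by at most [kappa * eta * t = t * e / 2] into [Gamma g]. Inactive
    constraints hold for small [t] through their slack. *)
Lemma tangent_Gamma w : tangent_cone (Gamma g) yb w <->
  forall i, active i -> dotp (a i) w <= 0.
Proof.
split; first by move=> Tw i; exact: tangent_active_le0.
move=> aw; apply/tangent_coneP => e e0.
have [kappa [d1 [k0 d10 Hk]]] := feas.
pose M := `|w| + 1; have M0 : 0 < M by rewrite ltr_wpDl.
pose eta := e / (2 * kappa); have eta0 : 0 < eta by rewrite divr_gt0// mulr_gt0.
have [d2 d20 Hd2] : exists2 d, 0 < d & forall i, forall t, 0 < t -> t < d ->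
    g (yb + t *: w) ord0 i <= eta * t.
  apply: uniform_radius => [j d d' d'0 d'd Hd t t0 td|i].
    by apply: Hd => //; exact: lt_le_trans d'd.
  have [ai|ai] := boolP (active i).
    have [d d0 Hd] := approx1 i (divr_gt0 eta0 M0).
    exists (d / M) => [|t t0 td]; first by rewrite divr_gt0.
    have tw : `|t *: w| = t * `|w| by rewrite normrZ gtr0_norm.
    have tM : t * `|w| <= t * M by rewrite ler_wpM2l ?(ltW t0)// lerDl.
    have twd : `|t *: w| < d.
      by rewrite tw; apply: le_lt_trans tM _; rewrite -ltr_pdivlMr.
    have := Hd _ twd; rewrite (eqP ai) subr0 dotpZr ler_norml => /andP[_].
    have := aw i ai; rewrite -(pmulr_rle0 _ t0) => E1 E2.
    have : eta / M * `|t *: w| <= eta / M * (t * M).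
      by rewrite tw ler_wpM2l// divr_ge0 ?ltW.
    have -> : eta / M * (t * M) = eta * t by field; rewrite gt_eqF.
    lra.
  have gn : g yb ord0 i < 0 by rewrite lt_neqAle ai; exact: Gyb.
  have [d d0 Hd] := approx1 i ltr01.
  pose K := M + m%:R * `|a i| * M.
  have K0 : 0 < K by rewrite ltr_wpDr// !mulr_ge0// ltW.
  exists (Num.min (d / M) (- g yb ord0 i / K)).
    by rewrite lt_min !divr_gt0// oppr_gt0.
  move=> t t0; rewrite lt_min => /andP[td tg].
  have tw : `|t *: w| = t * `|w| by rewrite normrZ gtr0_norm.
  have tM : t * `|w| <= t * M by rewrite ler_wpM2l ?(ltW t0)// lerDl.
  have twd : `|t *: w| < d.
    by rewrite tw; apply: le_lt_trans tM _; rewrite -ltr_pdivlMr.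
  have := Hd _ twd; rewrite mul1r ler_norml => /andP[_ E1].
  have E2 : dotp (a i) (t *: w) <= m%:R * `|a i| * (t * M).
    apply: le_trans (ler_norm _) _; apply: le_trans (dotp_le_norm _ _) _.
    by rewrite ler_wpM2l ?mulr_ge0// tw.
  move: tg; rewrite ltr_pdivlMr// /K mulrDr => tg.
  have := mulr_ge0 (ltW eta0) (ltW t0).
  have : m%:R * `|a i| * (t * M) = t * (m%:R * `|a i| * M) by ring.
  rewrite tw in E1; lra.
pose t := Num.min (Num.min e (d1 / M)) d2 / 2.
have r0 : 0 < Num.min (Num.min e (d1 / M)) d2 by rewrite !lt_min e0 d20 divr_gt0.
have t0 : 0 < t by rewrite divr_gt0.
have r2 : t < Num.min (Num.min e (d1 / M)) d2 by rewrite /t; lra.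
move: r2; rewrite !lt_min => /andP[/andP[te td1] td2].
have [|||y' Gy' yy'] := Hk (yb + t *: w) (eta * t).
- rewrite [yb + _]addrC addrK normrZ gtr0_norm//.
  apply: (@le_lt_trans _ _ (t * M)); last by rewrite -ltr_pdivlMr.
  by rewrite ler_wpM2l ?(ltW t0)// lerDl.
- exact: mulr_gt0.
- by move=> i; exact: Hd2.
exists t, (t^-1 *: (y' - yb)); split=> //; last first.
  by rewrite scalerA divff ?gt_eqF// scale1r addrC subrK.
have -> : t^-1 *: (y' - yb) - w = t^-1 *: (y' - (yb + t *: w)).
  rewrite opprD addrA [RHS]scalerBr scalerA mulVf ?gt_eqF// scale1r.
  by [].
rewrite normrZ gtr0_norm ?invr_gt0// distrC ltr_pdivrMl//.
apply: le_lt_trans yy' _; rewrite /eta.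
have -> : kappa * (e / (2 * kappa) * t) = t * e / 2 by field; rewrite gt_eqF.
have := mulr_gt0 t0 e0; lra.
Qed.

(** Presents the critical cone as a polyhedral cone over a fixed finite index type: inactive
    constraints contribute the zero vector, and the two signs of [ys] encode orthogonality. *)
Definition critical_gens (ys : 'rV[R]_m) (j : 'I_q + bool) : 'rV[R]_m :=
  match j with
  | inl i => if active i then a i else 0
  | inr b => if b then ys else - ys
  end.

Lemma critical_gensP ys v : (forall j, dotp (critical_gens ys j) v <= 0) <->
  (forall i, active i -> dotp (a i) v <= 0) /\ dotp ys v = 0.
Proof.
split=> [K|[av ysv] [i|b]].
- split=> [i ai|]; first by have := K (inl i); rewrite /= ai.
  have := K (inr true); have := K (inr false); rewrite /= dotpNl oppr_le0 => h1 h2.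
  by apply/eqP; rewrite eq_le h1 h2.
- by rewrite /=; case: ifP => [/av//|_]; rewrite dotp0l.
- by rewrite /=; case: b; rewrite ?dotpNl ysv ?oppr0.
Qed.

Section Multiplier.
Variables (ys : 'rV[R]_m) (lam : 'rV[R]_q) (S : 'M[R]_m).

(** [Lambda_bar] with the normal cone to the orthant spelled out as sign and complementarity
    conditions. *)
Definition multiplier (l : 'rV[R]_q) :=
  [/\ forall i, 0 <= l ord0 i, forall i, l ord0 i * g yb ord0 i = 0 &
     \sum_i l ord0 i *: a i = ys].

Hypothesis lamP : multiplier lam.
Hypothesis SE : S = \sum_i lam ord0 i *: H i.

Let dotS x y : dotp (x *m S) y = \sum_i lam ord0 i * dotp (x *m H i) y.
Proof.
rewrite SE mulmx_sumr dotp_suml; apply: eq_bigr => i _.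
by rewrite -scalemxAr dotpZl.
Qed.

Let dotys x : dotp ys x = \sum_i lam ord0 i * dotp (a i) x.
Proof.
case: lamP => _ _ <-; rewrite dotp_suml; apply: eq_bigr => i _.
by rewrite dotpZl.
Qed.

(** The expansions of the constraints are added with weights [lam]: the first-order terms add up to
    [ys], complementarity removes the values at [yb], and feasibility makes the values at [yb + h]
    nonpositive. *)
Lemma lagrangian_lower e : 0 < e -> exists2 d, 0 < d & forall h, `|h| < d ->
  Gamma g (yb + h) -> 2^-1 * dotp (h *m S) h - e * `|h| ^+ 2 <= - dotp ys h.
Proof.
move=> e0; have [lam0 lamc _] := lamP.
pose L := \sum_i lam ord0 i + 1.
have L0 : 0 < L by rewrite ltr_wpDl// sumr_ge0.
have [d d0 Hd] : exists2 d, 0 < d & forall i h, `|h| < d ->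
    `|g (yb + h) ord0 i - g yb ord0 i - dotp (a i) h - 2^-1 * dotp (h *m H i) h|
      <= e / L * `|h| ^+ 2.
  apply: uniform_radius => [j d d' _ d'd Hd h hd|i].
    by apply: Hd; exact: lt_le_trans d'd.
  by apply: approx2; rewrite divr_gt0.
exists d => // h hd Gh.
have E : - dotp ys h - 2^-1 * dotp (h *m S) h >=
    - \sum_i lam ord0 i * (e / L * `|h| ^+ 2).
  rewrite dotys dotS mulr_sumr -!sumrN -big_split; apply: ler_sum => i _.
  have := ler_wpM2l (lam0 i) (Hd i h hd).
  have := ler_wpM2l (lam0 i)
    (ler_norm (- (g (yb + h) ord0 i - g yb ord0 i - dotp (a i) h -
       2^-1 * dotp (h *m H i) h))).
  rewrite normrN; have := lamc i.
  have : lam ord0 i * g (yb + h) ord0 i <= 0.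
    by apply: mulr_ge0_le0 => //; exact: Gh.
  rewrite /=; lra.
have : \sum_i lam ord0 i * (e / L * `|h| ^+ 2) <= e * `|h| ^+ 2.
  rewrite -mulr_suml mulrA ler_wpM2r ?sqr_ge0// mulrA ler_pdivrMr// mulrC.
  by rewrite ler_wpM2l ?(ltW e0)// lerDl.
lra.
Qed.

(** Feasibility bounds the active gradients from above along [u], hence also [ys], their nonnegative
    combination; the opposite sign [- ys] is controlled by the bound on the objective. So rescaled
    feasible points with a good objective are nearly critical. *)
Lemma near_critical M N e : 0 < M -> 0 < N -> 0 < e ->
  exists2 d, 0 < d & forall t u, 0 < t -> t < d -> `|u| <= M ->
    Gamma g (yb + t *: u) -> - dotp ys u <= t * N ->
    forall j, dotp (critical_gens ys j) u <= e.
Proof.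
move=> M0 N0 e0; have [lam0 lamc _] := lamP.
pose L := \sum_i lam ord0 i + 1.
have L0 : 0 < L by rewrite ltr_wpDl// sumr_ge0.
have L1 : 1 <= L by rewrite lerDr sumr_ge0.
have [d d0 Hd] : exists2 d, 0 < d & forall i h, `|h| < d ->
    `|g (yb + h) ord0 i - g yb ord0 i - dotp (a i) h| <= e / L / M * `|h|.
  apply: uniform_radius => [j d d' _ d'd Hd h hd|i].
    by apply: Hd; exact: lt_le_trans d'd.
  by apply: approx1; rewrite !divr_gt0.
exists (Num.min (d / M) (e / N)); first by rewrite lt_min !divr_gt0.
move=> t u t0; rewrite lt_min => /andP[td te] uM Gu ysu.
have A i : active i -> dotp (a i) u <= e / L.
  move=> /eqP ai; have tu : `|t *: u| = t * `|u| by rewrite normrZ gtr0_norm.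
  have := Hd i (t *: u); rewrite tu ai subr0 dotpZr => E.
  have {}E := E (le_lt_trans (ler_wpM2l (ltW t0) uM) _).
  rewrite -ltr_pdivlMr// in E; have {E} := E td.
  rewrite ler_norml => /andP[E _]; have Gi := Gu i.
  have E1 : t * dotp (a i) u <= t * (e / L / M * `|u|) by lra.
  rewrite ler_pM2l// in E1; apply: le_trans E1 _.
  by rewrite -mulrA ger_pMr ?divr_gt0// ler_pdivrMl// mulr1.
have eL : e / L <= e by rewrite ger_pMr// invf_le1.
case=> [i|[]] /=.
- by case: ifP => [/A/le_trans|_]; [apply|rewrite dotp0l ltW].
- rewrite dotys; apply: (@le_trans _ _ (\sum_i lam ord0 i * (e / L))).
    apply: ler_sum => i _; have [ai|ai] := boolP (active i).
      by rewrite ler_wpM2l// A.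
    have : lam ord0 i = 0.
      by move/eqP: (lamc i); rewrite mulf_eq0 => /orP[/eqP//|/(negP ai)].
    by move=> ->; rewrite !mul0r.
  rewrite -mulr_suml mulrA ler_pdivrMr// mulrC ler_wpM2l ?(ltW e0)//.
  by rewrite lerDl.
- rewrite dotpNl; apply: le_trans ysu _.
  by rewrite -ler_pdivlMr// ltW.
Qed.

(* Strong duality for the linear program maximising [v H_l v] over multipliers
   [l]: [w] is a dual solution, obtained from Farkas' lemma in dimension m + 1. *)
Lemma second_order_direction v :
  (forall i, active i -> dotp (a i) v <= 0) ->
  (forall l, multiplier l -> \sum_i l ord0 i * dotp (v *m H i) v <=
     \sum_i lam ord0 i * dotp (v *m H i) v) ->
  exists w, (forall i, active i -> dotp (a i) v = 0 ->
     dotp (a i) w + dotp (v *m H i) v <= 0) /\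
     0 <= dotp ys w + dotp (v *m S) v.
Proof.
move=> av lmax; apply: contrapT => nex; have [lam0 lamc lamE] := lamP.
pose I i := active i && (dotp (a i) v == 0).
pose be i := dotp (v *m H i) v; pose V := dotp (v *m S) v.
pose f (j : 'I_q + 'I_1) : 'rV[R]_(m + 1) :=
  match j with
  | inl i => if I i then row_mx (a i) (be i)%:M else 0
  | inr _ => row_mx (- ys) (- V)%:M
  end.
have scal (b : R) (x : 'rV[R]_1) : dotp b%:M x = b * x ord0 ord0.
  by rewrite /dotp big_ord1 mxE eqxx mulr1n.
(* A vector [(x1, t)] with [t > 0] in the polar of the generators would give the excluded direction
   [w = x1 / t]. Hence the last unit vector is a nonnegative combination of the generators. *)
have [x fx|y y0 cE] := @farkas R _ _ f (row_mx 0 1%:M).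
  move: fx; rewrite -[x]hsubmxK; move: (lsubmx x) (rsubmx x) => x1 x2 fx.
  rewrite dotp_row_mx dotp0l add0r scal mul1r leNgt; apply/negP => t0.
  set t := x2 ord0 ord0 in t0; apply: nex; exists (t^-1 *: x1); split.
    move=> i ai aiv; have := fx (inl i).
    rewrite /= /I ai aiv eqxx /= dotp_row_mx scal -/t => E.
    by rewrite dotpZr -(pmulr_rle0 _ t0) mulrDr mulVKf ?gt_eqF// [t * _]mulrC.
  have := fx (inr ord0); rewrite /= dotp_row_mx scal -/t dotpNl => E.
  rewrite dotpZr -/V -(pmulr_rge0 _ t0) mulrDr mulVKf ?gt_eqF//; lra.
pose mu i := if I i then y (inl i) else 0.
pose rho := y (inr ord0).
have rho0 : 0 < 1 + rho by rewrite ltr_pwDl// y0.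
have {}cE : row_mx 0 1%:M =
    \sum_i mu i *: row_mx (a i) (be i)%:M + rho *: row_mx (- ys) (- V)%:M.
  rewrite cE big_sumType big_ord1; congr (_ + _); apply: eq_bigr => i _.
  by rewrite /f /mu; case: ifP => // _; rewrite scaler0 scale0r.
have cE1 x : 0 = \sum_i mu i * dotp (a i) x - rho * dotp ys x.
  have := congr1 (fun c => dotp c (row_mx x 0)) cE.
  rewrite dotpDl dotp_suml dotpZl !dotp_row_mx dotp0l !dotp0r !addr0 dotpNl mulrN.
  move=> E; rewrite [LHS]E; congr (_ - _).
  by apply: eq_bigr => i _; rewrite dotpZl dotp_row_mx dotp0r addr0.
have cE2 : 1 = \sum_i mu i * be i - rho * V.
  have := congr1 (fun c => dotp c (row_mx 0 1%:M)) cE.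
  have E1 (b : R) (c : 'rV[R]_m) : dotp (row_mx c b%:M) (row_mx 0 1%:M) = b.
    by rewrite dotp_row_mx dotp0r add0r scal mxE eqxx mulr1.
  rewrite dotpDl dotp_suml dotpZl !E1 mulrN => ->; congr (_ + _).
  by apply: eq_bigr => i _; rewrite dotpZl E1.
(* The combination says that the [mu i *: a i] sum to [rho *: ys] and the [mu i * be i] to
   [1 + rho * V]. Since [rho] may vanish, [lam] is added before normalising; the resulting
   multiplier has objective [V + 1 / (1 + rho)], against the maximality of [lam]. *)
pose l : 'rV[R]_q := \row_i ((lam ord0 i + mu i) / (1 + rho)).
have mu0 i : 0 <= mu i by rewrite /mu; case: ifP.
have lP : multiplier l.
  split=> [i|i|].
  - by rewrite mxE divr_ge0 ?(ltW rho0)// addr_ge0.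
  - rewrite mxE mulrAC mulrDl lamc add0r /mu /I; case: ifP => [/andP[/eqP-> _]|_].
      by rewrite mulr0 mul0r.
    by rewrite !mul0r.
  (* [cE1] speaks of inner products only, so the equality is tested against the difference [D]
     itself. *)
  - apply/eqP; rewrite -subr_eq0 -normr_le0; apply: le_trans (norm_le_enorm _) _.
    set D := _ - ys; suff : dotp D D = 0 by rewrite /enorm => ->; rewrite sqrtr0.
    have {1}-> : D = \sum_i l ord0 i *: a i - ys by [].
    rewrite dotpDl dotpNl dotp_suml.
    have -> : \sum_i dotp (l ord0 i *: a i) D = (1 + rho)^-1 *
        (\sum_i lam ord0 i * dotp (a i) D + \sum_i mu i * dotp (a i) D).
      rewrite -big_split mulr_sumr; apply: eq_bigr => i _.
      by rewrite dotpZl mxE /=; ring.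
    rewrite -dotys; have /esym/eqP := cE1 D; rewrite subr_eq0 => /eqP->.
    by field; rewrite gt_eqF.
have := lmax l lP.
have -> : \sum_i l ord0 i * dotp (v *m H i) v = (1 + rho)^-1 *
    (\sum_i lam ord0 i * dotp (v *m H i) v + \sum_i mu i * be i).
  rewrite -big_split mulr_sumr; apply: eq_bigr => i _.
  by rewrite mxE /be /=; ring.
rewrite -dotS -/V ler_pdivrMl//; lra.
Qed.

(** Along the arc [yb + t v + (t ^+ 2 / 2) w] an inactive constraint keeps slack of order 1 and an
    active one with [dotp (a i) v < 0] gains order [t]. For the others the coefficient of
    [t ^+ 2 / 2] is nonpositive by the choice of [w], and the remainder is absorbed by
    [eta * t ^+ 2]. *)
Lemma recovery_feasible v w eta : 0 < eta ->
  (forall i, active i -> dotp (a i) v <= 0) ->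
  (forall i, active i -> dotp (a i) v = 0 ->
     dotp (a i) w + dotp (v *m H i) v <= 0) ->
  exists2 d, 0 < d & forall i t, 0 < t -> t < d ->
    g (yb + t *: (v + (t / 2) *: w)) ord0 i <= eta * t ^+ 2.
Proof.
move=> eta0 av aw; pose M := `|v| + `|w| + 1.
have M0 : 0 < M by rewrite ltr_wpDl// addr_ge0.
have hM t : 0 < t -> t < 1 -> `|t *: (v + (t / 2) *: w)| <= t * M.
  move=> t0 t1; rewrite normrZ gtr0_norm// ler_wpM2l ?(ltW t0)//.
  apply: le_trans (ler_normD _ _) _; rewrite normrZ gtr0_norm ?divr_gt0//.
  have : (1 - t / 2) * `|w| >= 0 by rewrite mulr_ge0//; lra.
  rewrite /M; lra.
have hd t d : 0 < t -> t < 1 -> t < d / M ->  `|t *: (v + (t / 2) *: w)| < d.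
  by move=> t0 t1 td; apply: le_lt_trans (hM t t0 t1) _; rewrite -ltr_pdivlMr.
have aC i x c : `|x| <= c -> dotp (a i) x <= m%:R * `|a i| * c.
  move=> xc; apply: le_trans (ler_norm _) _; apply: le_trans (dotp_le_norm _ _) _.
  by rewrite ler_wpM2l ?mulr_ge0.
apply: uniform_radius => [j d d' _ d'd Hd t t0 td|i].
  by apply: Hd => //; exact: lt_le_trans d'd.
have et t : 0 < t -> 0 <= eta * t ^+ 2.
  by move=> t0; rewrite mulr_ge0 ?(ltW eta0)// sqr_ge0.
have [/eqP ai|ai] := boolP (active i); last first.
  have gn : g yb ord0 i < 0 by rewrite lt_neqAle ai; exact: Gyb.
  have [d d0 Hd] := approx1 i ltr01.
  pose K := m%:R * `|a i| * M + M.
  have K0 : 0 < K by rewrite ltr_wpDl// !mulr_ge0// ltW.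
  exists (Num.min (Num.min 1 (d / M)) (- g yb ord0 i / K)).
    by rewrite !lt_min ltr01 !divr_gt0// oppr_gt0.
  move=> t t0; rewrite !lt_min => /andP[/andP[t1 td]]; rewrite ltr_pdivlMr// => tK.
  have := Hd _ (hd t d t0 t1 td); rewrite mul1r ler_norml => /andP[_ E1].
  have E2 := aC i _ _ (hM t t0 t1).
  have E3 := hM t t0 t1; have E4 := et t t0.
  rewrite /K in tK; lra.
have [aiv|aiv] := eqVneq (dotp (a i) v) 0; last first.
  have aiv0 : 0 < - dotp (a i) v.
    by rewrite oppr_gt0 lt_neqAle aiv av//; exact/eqP.
  have [|d d0 Hd] := approx1 i (e := - dotp (a i) v / (2 * M)).
    by rewrite divr_gt0// mulr_gt0.
  pose K := m%:R * `|a i| * `|w| + 1.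
  have K0 : 0 < K by rewrite ltr_wpDl// !mulr_ge0.
  exists (Num.min (Num.min 1 (d / M)) (- dotp (a i) v / K)).
    by rewrite !lt_min ltr01 !divr_gt0.
  move=> t t0; rewrite !lt_min => /andP[/andP[t1 td]]; rewrite ltr_pdivlMr// => tK.
  have := Hd _ (hd t d t0 t1 td); rewrite ler_norml ai subr0 => /andP[_].
  rewrite (dotpZr t) dotpDr (dotpZr (t / 2)) => E1.
  have E2 := aC i w _ (lexx _).
  have E3 : - dotp (a i) v / (2 * M) * `|t *: (v + (t / 2) *: w)| <=
      t * (- dotp (a i) v / 2).
    have -> : t * (- dotp (a i) v / 2) = - dotp (a i) v / (2 * M) * (t * M).
      by field; rewrite gt_eqF.
    by rewrite ler_wpM2l ?hM// divr_ge0// ?(ltW aiv0)// mulr_ge0// ltW.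
  have E4 := et t t0.
  have E5 : t * (t / 2 * dotp (a i) w) <= t * (- dotp (a i) v / 2).
    rewrite ler_pM2l//.
    have : t / 2 * dotp (a i) w <= t / 2 * (m%:R * `|a i| * `|w|).
      by rewrite ler_wpM2l// divr_ge0// ltW.
    rewrite /K in tK; lra.
  lra.
have [|d d0 Hd] := approx2 i (e := eta / (2 * M ^+ 2)).
  by rewrite divr_gt0// mulr_gt0// exprn_gt0.
pose C := `|dotp (w *m H i) v| + `|dotp (v *m H i) w| + `|dotp (w *m H i) w| + 1.
have C0 : 0 < C by rewrite ltr_wpDl// !addr_ge0.
exists (Num.min (Num.min 1 (d / M)) (eta / C)).
  by rewrite !lt_min ltr01 !divr_gt0.
move=> t t0; rewrite !lt_min => /andP[/andP[t1 td]]; rewrite ltr_pdivlMr// => tC.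
have := Hd _ (hd t d t0 t1 td); rewrite ler_norml ai subr0 => /andP[_].
have -> : dotp (a i) (t *: (v + (t / 2) *: w)) = t ^+ 2 / 2 * dotp (a i) w.
  by rewrite (dotpZr t) dotpDr (dotpZr (t / 2)) aiv; field.
have -> : 2^-1 * dotp ((t *: (v + (t / 2) *: w)) *m H i) (t *: (v + (t / 2) *: w)) =
  t ^+ 2 / 2 * (dotp (v *m H i) v + t / 2 * (dotp (w *m H i) v + dotp (v *m H i) w) +
     t / 2 * (t / 2 * dotp (w *m H i) w)).
  rewrite -scalemxAl mulmxDl -scalemxAl (dotpZr t) (dotpZl t) dotpDr !dotpDl.
  by rewrite !(dotpZr (t / 2)) !(dotpZl (t / 2)); field.
have E2 := aw i (introT eqP ai) aiv.
have E3 : eta / (2 * M ^+ 2) * `|t *: (v + (t / 2) *: w)| ^+ 2 <=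
    t ^+ 2 / 2 * eta.
  have -> : t ^+ 2 / 2 * eta = eta / (2 * M ^+ 2) * (t * M) ^+ 2.
    by field; rewrite gt_eqF.
  rewrite ler_wpM2l//; first by rewrite divr_ge0 ?(ltW eta0)// mulr_ge0// sqr_ge0.
  by rewrite lerXn2r ?nnegrE ?hM// mulr_ge0 ?ltW.
set X := dotp (a i) w in E2 *; set Y := dotp (v *m H i) v in E2 *.
have E4 : t / 2 * (dotp (w *m H i) v + dotp (v *m H i) w) +
     t / 2 * (t / 2 * dotp (w *m H i) w) <= eta.
  have h1 := ler_norm (dotp (w *m H i) v); have h2 := ler_norm (dotp (v *m H i) w).
  have h3 : t / 2 * dotp (w *m H i) w <= `|dotp (w *m H i) w|.
    apply: le_trans (ler_norm _) _; rewrite normrM ler_piMl// ger0_norm ?divr_ge0 ?ltW//.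
    lra.
  rewrite -mulrDr; apply: (@le_trans _ _ (t / 2 * C)); last by move: tC; lra.
  by rewrite ler_wpM2l ?divr_ge0 ?(ltW t0)// /C; lra.
have t2 : 0 <= t ^+ 2 / 2 by rewrite divr_ge0 ?sqr_ge0.
have E5 := ler_wpM2l t2 E2; have E6 := ler_wpM2l t2 E4.
move=> E1; lra.
Qed.

(** The arc is corrected to a feasible point at distance of order [eta * t ^+ 2], that is [eta * t]
    in the rescaled variable. Its objective is governed by [- dotp ys w / 2], at most half of
    [dotp (v *m S) v]: the dual direction matches the Lagrangian lower bound. *)
Lemma recovery v w : (forall i, active i -> dotp (a i) v <= 0) -> dotp ys v = 0 ->
  (forall i, active i -> dotp (a i) v = 0 ->
     dotp (a i) w + dotp (v *m H i) v <= 0) ->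
  0 <= dotp ys w + dotp (v *m S) v ->
  forall e, 0 < e -> exists2 d, 0 < d & forall t, 0 < t -> t < d ->
    exists u, [/\ `|u - v| <= e, Gamma g (yb + t *: u) &
      - dotp ys u <= t * (2^-1 * dotp (v *m S) v + e)].
Proof.
move=> av ysv aw ysw e e0; have [kappa [d1 [k0 d10 Hk]]] := feas.
pose A := m%:R * `|ys| * kappa + kappa + 1.
have A0 : 0 < A by rewrite ltr_wpDl// addr_ge0 ?mulr_ge0// ltW.
pose eta := e / (2 * A); have eta0 : 0 < eta by rewrite divr_gt0// mulr_gt0.
have [d d0 Hd] := recovery_feasible eta0 av aw.
pose M := `|v| + `|w| + 1; have M0 : 0 < M by rewrite ltr_wpDl// addr_ge0.
exists (Num.min (Num.min (Num.min 1 d) (d1 / M)) (e / M)).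
  by rewrite !lt_min ltr01 d0 !divr_gt0.
move=> t t0; rewrite !lt_min => /andP[/andP[/andP[t1 td]]].
rewrite !ltr_pdivlMr// => tM te.
pose p := yb + t *: (v + (t / 2) *: w).
have [|||y Gy yp] := Hk p (eta * t ^+ 2).
- rewrite /p [yb + _]addrC addrK normrZ gtr0_norm//; apply: le_lt_trans tM.
  rewrite ler_wpM2l ?(ltW t0)//.
  apply: le_trans (ler_normD _ _) _; rewrite normrZ gtr0_norm ?divr_gt0//.
  have : (1 - t / 2) * `|w| >= 0 by rewrite mulr_ge0//; lra.
  rewrite /M; lra.
- by rewrite mulr_gt0// exprn_gt0.
- by move=> i; exact: Hd.
have {}yp : `|t^-1 *: (y - p)| <= kappa * eta * t.
  rewrite normrZ gtr0_norm ?invr_gt0// distrC ler_pdivrMl//.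
  by apply: le_trans yp _; rewrite le_eqVlt; apply/orP; left; apply/eqP; ring.
pose r := t^-1 *: (y - p); exists (v + (t / 2) *: w + r).
have kA : kappa * eta <= e / 2.
  have -> : e / 2 = A * eta by rewrite /eta; field; rewrite gt_eqF.
  rewrite ler_wpM2r ?(ltW eta0)// /A.
  have : 0 <= m%:R * `|ys| * kappa by rewrite !mulr_ge0// ltW.
  lra.
have ke : 0 <= kappa * eta by rewrite mulr_ge0 ?ltW.
split.
- rewrite -[v + _ + r]addrA [v + _]addrC addrK; apply: le_trans (ler_normD _ _) _.
  rewrite normrZ gtr0_norm ?divr_gt0//.
  have h1 : kappa * eta * t <= e / 2.
    by apply: le_trans kA; rewrite ler_piMr// ltW.
  have h2 : t * `|w| <= t * M.
    by rewrite ler_wpM2l ?(ltW t0)// /M; have := normr_ge0 v; lra.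
  rewrite -/r in yp; lra.
- suff -> : yb + t *: (v + (t / 2) *: w + r) = y by [].
  by rewrite /r scalerDr scalerA divff ?gt_eqF// scale1r addrA -/p addrC subrK.
- rewrite !dotpDr (dotpZr (t / 2)) ysv add0r.
  have h1 : - dotp ys r <= e * t.
    apply: le_trans (ler_norm _) _; rewrite normrN.
    apply: le_trans (dotp_le_norm _ _) _.
    apply: (@le_trans _ _ (m%:R * `|ys| * (kappa * eta * t))).
      by rewrite ler_wpM2l ?mulr_ge0.
    have -> : m%:R * `|ys| * (kappa * eta * t) = m%:R * `|ys| * kappa * eta * t by ring.
    rewrite ler_wpM2r ?(ltW t0)//; apply: (@le_trans _ _ (A * eta)).
      by rewrite ler_wpM2r ?(ltW eta0)// /A; lra.
    have -> : A * eta = e / 2 by rewrite /eta; field; rewrite gt_eqF.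
    by lra.
  have := mulr_ge0 (ltW t0) ysw; lra.
Qed.

(* Keeps the section variables, which [lra] needs, but none of the many local
   hypotheses, which slow it down *)
Local Ltac lra_goal :=
  clear -R m q g yb a H Gyb feas approx1 approx2 active ys lam S lamP SE dotS dotys;
  lra.

(* The point of the graph is produced by minimising
   [- (ys + t c) . (y - yb) + al / 2 |y - yb - t v|^2] over [Gamma g] near [yb]. *)
Lemma normal_graph_approx v z :
  continuous g -> S^T = S ->
  (forall i, active i -> dotp (a i) v <= 0) -> dotp ys v = 0 ->
  (forall l, multiplier l -> \sum_i l ord0 i * dotp (v *m H i) v <=
     \sum_i lam ord0 i * dotp (v *m H i) v) ->
  (forall x, (forall j, dotp (critical_gens ys j) x <= 0) -> dotp z x <= 0) ->
  dotp z v = 0 ->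
  forall e, 0 < e -> exists2 d, 0 < d & forall t, 0 < t -> t < d ->
    exists u us, [/\ `|u - v| <= e, `|us - (v *m S + z)| <= e,
      Gamma g (yb + t *: u) &
      polar (tangent_cone (Gamma g) (yb + t *: u)) (ys + t *: us)].
Proof.
move=> cg Ssym av ysv lmax zK zv e e0.
have [w [aw ysw]] := second_order_direction av lmax.
have [y y0 zE] := farkas zK.
have [C C0 HC] := norm_mulmx_le S.
(* The term [m%:R * C] compensates a possibly indefinite [S]; adding 2 leaves coefficient 1 in
   [coer]. *)
pose al : R := m%:R * C + 2.
have al0 : 0 < al by rewrite ltr_wpDl// mulr_ge0// ltW.
have coer x : dotp x x <= 2^-1 * dotp (x *m S) x + al / 2 * dotp x x.
  have h1 : - dotp (x *m S) x <= m%:R * C * dotp x x.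
    apply: le_trans (ler_norm _) _; rewrite normrN.
    apply: le_trans (dotp_le_norm _ _) _; rewrite -!mulrA ler_wpM2l//.
    apply: (@le_trans _ _ (C * `|x| * `|x|)); first by rewrite ler_wpM2r.
    by rewrite -mulrA ler_wpM2l ?(ltW C0)// -expr2 norm_sq_le_dotp.
  rewrite /al; lra.
pose c := v *m S + z; pose V := dotp (v *m S) v.
(* The normal constructed at the end is off by [al] times [u - v], so [u] has to be within [ef] of
   [v]. *)
pose ef := e / (al + 1); have ef0 : 0 < ef by rewrite divr_gt0// addr_gt0.
have ef2 : 0 < ef ^+ 2 by rewrite exprn_gt0.
(* A preliminary bound on [|u - v|]: [near_critical] requires a bounded direction before the fine
   estimate can be made. *)
pose B := 2 * (m%:R * `|z|) + `|v| ^+ 2 + 3.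
have B3 : 3 <= B by rewrite lerDr addr_ge0 ?mulr_ge0 ?sqr_ge0.
pose Mu := `|v| + B.
have Mu0 : 0 < Mu by have := normr_ge0 v; rewrite /Mu; lra.
pose N := m%:R * `|c| * Mu + `|V| + 2.
have N0 : 0 < N by rewrite ltr_wpDl// addr_ge0// !mulr_ge0// ltW.
(* The value 1/4 lets [e1 * |u| ^+ 2] be absorbed in the preliminary bound; the other value makes it
   at most [ef ^+ 2 / 8] in the fine one. *)
pose e1 := Num.min (4^-1) (ef ^+ 2 / (8 * Mu ^+ 2)).
have e10 : 0 < e1.
  rewrite lt_min invr_gt0 ltr0n /=.
  by apply: divr_gt0 => //; apply: mulr_gt0 => //; exact: exprn_gt0.
have e14 : e1 <= 4^-1 by rewrite ge_min lexx.
have e1M : e1 * Mu ^+ 2 <= ef ^+ 2 / 8.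
  have -> : ef ^+ 2 / 8 = ef ^+ 2 / (8 * Mu ^+ 2) * Mu ^+ 2.
    by field; rewrite gt_eqF.
  by rewrite ler_wpM2r ?sqr_ge0// ge_min lexx orbT.
have [d1 d10 Hlow] := lagrangian_lower e10.
pose Y := \sum_j y j + 1; have Y0 : 0 < Y by rewrite ltr_wpDl// sumr_ge0.
have [|d2 d20 Hnear] := near_critical Mu0 N0 (e := ef ^+ 2 / (8 * Y)).
  by rewrite divr_gt0// mulr_gt0.
pose om := Num.min 1 (ef ^+ 2 / 8).
have om0 : 0 < om by rewrite lt_min ltr01 divr_gt0.
have om1 : om <= 1 by rewrite ge_min lexx.
have ome : om <= ef ^+ 2 / 8 by rewrite ge_min lexx orbT.
pose Q := 1 + m%:R * `|c| + al / 2 * m%:R.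
have Q1 : 1 <= Q by rewrite /Q -addrA lerDl addr_ge0// mulr_ge0// divr_ge0 ?(ltW al0).
have Q0 : 0 < Q by exact: lt_le_trans Q1.
pose e' := om / Q; have e'0 : 0 < e' by rewrite divr_gt0.
have e'1 : e' <= 1 by rewrite ler_pdivrMr// mul1r; exact: le_trans Q1.
have [d3 d30 Hrec] := recovery av ysv aw ysw e'0.
pose r := d1 / 2; have r0 : 0 < r by rewrite divr_gt0.
exists (Num.min (Num.min d2 d3) (r / Mu)); first by rewrite !lt_min d20 d30 divr_gt0.
move=> t t0; rewrite !lt_min => /andP[/andP[td2 td3]]; rewrite ltr_pdivlMr// => tMu.
have [u0 [u0v Gu0 ysu0]] := Hrec t t0 td3.
pose b := - (ys + t *: c); pose p := yb + t *: v.
pose f x := dotp b x + al / 2 * dotp (x - p) (x - p).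
pose A := Gamma g `&` [set x | `|x - yb| <= r].
have nu0 : `|u0| <= Mu.
  rewrite -[u0](subrK v); apply: le_trans (ler_normD _ _) _.
  rewrite /Mu addrC lerD2l; apply: le_trans u0v _; move: e'1 B3; lra_goal.
have tu0 : `|yb + t *: u0 - yb| <= r.
  rewrite [yb + _]addrC addrK normrZ gtr0_norm//; apply: le_trans (ltW tMu).
  by rewrite ler_wpM2l// ltW.
have csub c' : continuous (fun x : 'rV[R]_m => x - c').
  exact: (continuous_rV_sub (@continuous_rV_id _ _) (@cst_continuous _ _ c')).
have cf : continuous f.
  apply: continuous_real_add.
    exact: (continuous_dotp (@cst_continuous _ _ b) (@continuous_rV_id _ _)).
  by apply: continuous_real_scale; apply: continuous_dotp; exact: csub.
have [|||x [Gx xr] xmin] := @exists_min R m f A (`|yb| + r) _ _ _ cf.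
- by exists (yb + t *: u0).
- apply: closedI; first exact: closed_Gamma.
  apply: (@closed_comp _ _ (fun x : 'rV[R]_m => `|x - yb|) [set x | x <= r]).
    by move=> x _; exact: (continuous_rV_norm (csub yb)).
  exact: closed_le.
- move=> x [_ /= xr]; rewrite -[x](subrK yb); apply: le_trans (ler_normD _ _) _.
  by rewrite addrC lerD2l.
pose u := t^-1 *: (x - yb).
have xE : x = yb + t *: u by rewrite /u scalerA divff ?gt_eqF// scale1r addrC subrK.
pose D := dotp (u - v) (u - v); pose s := `|u - v|.
have s0 : 0 <= s by exact: normr_ge0.
have sD : s ^+ 2 <= D by exact: norm_sq_le_dotp.
have fE x' : f (yb + t *: x') =
    dotp b yb + t * (- dotp ys x' - t * dotp c x') +
    al / 2 * (t * (t * dotp (x' - v) (x' - v))).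
  have -> : f (yb + t *: x') = dotp b (yb + t *: x') +
    al / 2 * dotp (t *: (x' - v)) (t *: (x' - v)).
    by rewrite /f /p opprD addrACA subrr add0r scalerBr.
  rewrite !(dotpZr t) !(dotpZl t) dotpDr (dotpZr t); congr (_ + _ + _).
  by rewrite /b dotpNl dotpDl (dotpZl t); ring.
pose D0 := dotp (u0 - v) (u0 - v).
have D0e : D0 <= m%:R * e'.
  apply: le_trans (ler_norm _) _; apply: le_trans (dotp_le_norm _ _) _.
  rewrite -mulrA ler_wpM2l//; apply: (@le_trans _ _ (e' * e')); first by rewrite ler_pM.
  by rewrite ger_pMr.
have cu0 : - dotp c u0 <= - V + m%:R * `|c| * e'.
  have cv : dotp c v = V by rewrite /c dotpDl zv addr0.
  have -> : dotp c u0 = V + dotp c (u0 - v) by rewrite dotpDr dotpNr cv; ring.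
  have := ler_norm (- dotp c (u0 - v)); rewrite normrN => h1.
  have h2 := dotp_le_norm c (u0 - v).
  have h3 : m%:R * `|c| * `|u0 - v| <= m%:R * `|c| * e' by rewrite ler_wpM2l ?mulr_ge0.
  by move: h1 h2 h3; lra_goal.
have main : - dotp ys u - t * dotp c u + t * (al / 2 * D) <= t * (- (2^-1 * V) + om).
  have h1 : f x <= f (yb + t *: u0) by apply: xmin.
  rewrite xE !fE -/D -/D0 in h1.
  have {}h1 : t * (- dotp ys u - t * dotp c u + t * (al / 2 * D)) <=
      t * (- dotp ys u0 - t * dotp c u0 + t * (al / 2 * D0)).
    by move: h1; lra_goal.
  rewrite ler_pM2l// in h1; apply: le_trans h1 _.
  have h2 := ler_wpM2l (ltW t0) cu0.
  have h3 : t * (al / 2 * D0) <= t * (al / 2 * (m%:R * e')).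
    by rewrite ler_pM2l// ler_wpM2l// divr_ge0// ltW.
  have h4 : om = e' * Q by rewrite /e' divfK// gt_eqF.
  by rewrite h4 /Q -/V in ysu0 *; move: ysu0 h2 h3; lra_goal.
have low : t * (2^-1 * dotp (u *m S) u - e1 * `|u| ^+ 2) <= - dotp ys u.
  have tur : `|t *: u| < d1.
    move: xr; rewrite /= xE [yb + _]addrC addrK => xr.
    by apply: le_lt_trans xr _; rewrite /r; move: d10; lra_goal.
  have := Hlow _ tur; rewrite -xE => /(_ Gx).
  rewrite normrZ gtr0_norm// -scalemxAl (dotpZl t) !(dotpZr t) => h1.
  by rewrite -(ler_pM2l t0); move: h1; lra_goal.
(* Comparing the competitor with the lower bound completes a square: [c = v S + z] and the symmetry
   of [S] turn the quadratic terms into those of [u - v], to which [coer] applies, and only [z] is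
   left as a linear term. *)
have key : D <= dotp z u + e1 * `|u| ^+ 2 + om.
  have h1 : 2^-1 * dotp (u *m S) u - e1 * `|u| ^+ 2 - dotp c u + al / 2 * D <=
      - (2^-1 * V) + om.
    by rewrite -(ler_pM2l t0); move: main low; lra_goal.
  have h2 := coer (u - v); rewrite -/D in h2.
  have h3 : dotp ((u - v) *m S) (u - v) = dotp (u *m S) u - 2 * dotp (v *m S) u + V.
    have h4 : dotp (u *m S) v = dotp (v *m S) u by rewrite dotpM Ssym dotpC.
    by rewrite mulmxBl !(dotpDl, dotpDr, dotpNl, dotpNr) h4 /V; ring.
  by rewrite h3 in h2; move: h1 h2; rewrite /c dotpDl; lra_goal.
have uM : `|u| <= `|v| + s.
  by rewrite -[u in leLHS](subrK v) addrC; exact: ler_normD.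
have zu : dotp z u <= m%:R * `|z| * s.
  have -> : dotp z u = dotp z (u - v) by rewrite dotpDr dotpNr zv subr0.
  by apply: le_trans (ler_norm _) _; exact: dotp_le_norm.
have sB : s <= B.
  rewrite leNgt; apply/negP => Bs.
  have h1 : e1 * `|u| ^+ 2 <= 4^-1 * (2 * s ^+ 2 + 2 * `|v| ^+ 2).
    apply: ler_pM; rewrite ?sqr_ge0 ?(ltW e10)//.
    apply: (@le_trans _ _ ((`|v| + s) ^+ 2)).
      by rewrite lerXn2r ?nnegrE ?addr_ge0.
    by have := sqr_ge0 (`|v| - s); rewrite !expr2; lra_goal.
  have h2 : s * B <= s ^+ 2 by rewrite expr2 ler_wpM2l// ltW.
  have s1 : 1 <= s by move: Bs B3; lra_goal.
  have h3 : B <= s * B by rewrite ler_peMl//; move: B3; lra_goal.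
  have h4 : `|v| ^+ 2 <= s * `|v| ^+ 2 by rewrite ler_peMl ?sqr_ge0.
  have h5 : s * B = 2 * (m%:R * `|z| * s) + s * `|v| ^+ 2 + 3 * s by rewrite /B; ring.
  suff : s < s by rewrite ltxx.
  by move: key sD zu h1 h2 h3 h4 h5 om1 Bs B3; lra_goal.
have uMu : `|u| <= Mu by apply: le_trans uM _; rewrite lerD2l.
have ysu : - dotp ys u <= t * N.
  have h1 : dotp c u <= m%:R * `|c| * Mu.
    apply: le_trans (ler_norm _) _; apply: le_trans (dotp_le_norm _ _) _.
    by rewrite ler_wpM2l ?mulr_ge0.
  have h2 := ler_wpM2l (ltW t0) h1.
  have h3 : 0 <= t * (al / 2 * D).
    by rewrite !mulr_ge0 ?invr_ge0 ?dotp_ge0// ltW.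
  have h4 : t * (- (2^-1 * V) + om) <= t * (`|V| + 1).
    rewrite ler_pM2l//; apply: lerD => //.
    by have := ler_norm (- V); rewrite normrN; have := normr_ge0 V; lra_goal.
  by rewrite /N; move: main h2 h3 h4 t0; lra_goal.
have Gtu : Gamma g (yb + t *: u) by rewrite -xE.
(* Being bounded by now, [u] is nearly critical, and [z] is a nonnegative combination of the
   generators. *)
have zu8 : dotp z u <= ef ^+ 2 / 8.
  rewrite zE dotp_suml.
  apply: (@le_trans _ _ (\sum_j y j * (ef ^+ 2 / (8 * Y)))).
    apply: ler_sum => j _; rewrite dotpZl ler_wpM2l//.
    exact: (Hnear t u t0 td2 uMu Gtu ysu).
  rewrite -mulr_suml; have -> : ef ^+ 2 / 8 = Y * (ef ^+ 2 / (8 * Y)).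
    by field; rewrite gt_eqF.
  apply: ler_wpM2r; last by rewrite lerDl.
  by rewrite ltW// divr_gt0// mulr_gt0.
have sef : s <= ef.
  rewrite -(@ler_pXn2r _ 2)// ?nnegrE ?(ltW ef0)//; apply: le_trans sD _.
  have h1 : e1 * `|u| ^+ 2 <= e1 * Mu ^+ 2.
    by rewrite ler_wpM2l ?(ltW e10)// lerXn2r ?nnegrE// ltW.
  by move: key zu8 h1 e1M ome ef2; lra_goal.
have eE : e = al * ef + ef by rewrite /ef; field; rewrite gt_eqF// addr_gt0.
exists u, (c - al *: (u - v)); split=> //.
- by apply: le_trans sef _; rewrite eE lerDr mulr_ge0// ltW.
- rewrite addrC addKr normrN normrZ gtr0_norm//.
  rewrite eE; apply: (@le_trans _ _ (al * ef)); first by rewrite ler_pM2l.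
  by rewrite lerDl ltW.
- have -> : ys + t *: (c - al *: (u - v)) = - (b + al *: (x - p)).
    rewrite xE /b /p opprD opprK scalerBr scalerA addrA.
    by rewrite [in RHS]opprD addrACA subrr add0r -scalerBr scalerA [al * t]mulrC.
  (* Since [|x - yb| <= t * Mu < r], the ball constraint is inactive and [x] is a local minimiser
     over [Gamma g]. *)
  rewrite -xE; apply: (@polar_tangent_of_min _ _ _ b p al (r - t * Mu)) => //.
  + exact: ltW.
  + by rewrite subr_gt0.
  + move=> x' x'x Gx'; apply: xmin; split=> //=.
    have -> : x' - yb = (x' - x) + t *: u by rewrite xE opprD addrA subrK.
    apply: le_trans (ler_normD _ _) _; rewrite normrZ gtr0_norm//.
    by have := ler_wpM2l (ltW t0) uMu; move: x'x; lra_goal.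
Qed.

End Multiplier.

End SecondOrder.

(** * Multipliers for unions of polyhedral cones *)

Section Penalty.
Context {R : realType}.

Lemma continuous_lsubmx k l : continuous (@lsubmx R 1 k l).
Proof. by move=> x; apply: differentiable_continuous; exact: differentiable_lsubmx. Qed.

Lemma continuous_rsubmx k l : continuous (@rsubmx R 1 k l).
Proof. by move=> x; apply: differentiable_continuous; exact: differentiable_rsubmx. Qed.

Lemma continuous_rV_comp (T : topologicalType) k l (f : 'rV[R]_k -> 'rV[R]_l)
  (h : T -> 'rV[R]_k) : continuous f -> continuous h -> continuous (f \o h).
Proof. by move=> cf ch x; exact: (continuous_comp (ch x) (cf _)). Qed.

Lemma norm_row_mx_le k l (x : 'rV[R]_(k + l)) : `|x| <= `|lsubmx x| + `|rsubmx x|.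
Proof.
apply: norm_le_coord => [|i]; first by rewrite addr_ge0.
rewrite -{1}[x]hsubmxK mxE; case: splitP => j _.
  by apply: le_trans (coord_le_norm _ _) _; rewrite lerDl.
by apply: le_trans (coord_le_norm _ _) _; rewrite lerDr.
Qed.

Lemma closed_le0 (T : topologicalType) (f : T -> R) :
  continuous f -> closed [set x | f x <= 0].
Proof.
move=> cf; apply: (@closed_comp _ _ f [set x | x <= 0]); last exact: closed_le.
by move=> x _; exact: cf.
Qed.

(* Quadratic penalisation of [minimise c . d subject to d A in C]: the scaled
   residuals are exact normals to [C] and stay bounded. *)
Lemma approx_multiplier N M (A : 'M[R]_(N, M)) (C : set 'rV[R]_M)
    (c : 'rV[R]_N) kappa :
  closed C -> C 0 -> 0 <= kappa ->
  (forall d y, C y -> - (kappa * enorm (d *m A - y)) <= dotp c d) ->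
  forall e, 0 < e -> exists y nu, [/\ C y, polar (tangent_cone C y) nu,
    enorm nu <= 2 * kappa & `|c + nu *m A^T| <= e].
Proof.
move=> clC C0 k0 Hc e e0.
(* The estimates give [|d| ^+ 2 <= 2 kappa |r|] and [k |r| <= 2 kappa]; the final defect is [- d],
   whose square is thus at most [4 kappa ^+ 2 / k], below [e ^+ 2]. *)
pose k := 4 * kappa ^+ 2 / e ^+ 2 + 1.
have k1 : 1 <= k by rewrite lerDr divr_ge0 ?sqr_ge0 ?mulr_ge0 ?sqr_ge0.
have kgt0 : 0 < k by lra.
pose rr (x : 'rV[R]_(N + M)) := lsubmx x *m A - rsubmx x.
(* The last term is proximal: the linear term and the residual alone need not bound [d]. Its
   gradient [d] is what keeps the multiplier equation from being exact. *)
pose f x := dotp c (lsubmx x) + (k / 2 * dotp (rr x) (rr x) +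
  2^-1 * dotp (lsubmx x) (lsubmx x)).
have cr : continuous rr.
  apply: continuous_rV_sub; last exact: continuous_rsubmx.
  by apply: continuous_mulmxr; exact: continuous_lsubmx.
have cf : continuous f.
  apply: continuous_real_add.
    exact: (continuous_dotp (@cst_continuous _ _ c) (@continuous_lsubmx _ _)).
  apply: continuous_real_add; apply: continuous_real_scale; apply: continuous_dotp => //.
    exact: continuous_lsubmx.
  exact: continuous_lsubmx.
have f0 : f 0 = 0.
  by rewrite /f /rr !linear0 ?mul0mx ?subr0 ?addr0 !dotp0r !mulr0 !addr0.
pose S := [set x | C (rsubmx x)] `&` [set x | f x <= 0].
have Sest x : S x -> enorm (rr x) * k <= 2 * kappa /\
    dotp (lsubmx x) (lsubmx x) <= 2 * kappa * enorm (rr x).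
  move=> [Cx /= fx]; have h1 := Hc (lsubmx x) _ Cx; rewrite -/(rr x) in h1.
  rewrite /f -[dotp (rr x) _]enorm_sq in fx.
  have r0 := enorm_ge0 (rr x); have d0 := dotp_ge0 (lsubmx x).
  have q0 : 0 <= k / 2 * enorm (rr x) ^+ 2.
    by rewrite mulr_ge0 ?sqr_ge0// divr_ge0// ltW.
  split; last by lra.
  have [->|rn] := eqVneq (enorm (rr x)) 0; first by rewrite mul0r mulr_ge0.
  have rp : 0 < enorm (rr x) by rewrite lt_neqAle eq_sym rn.
  by rewrite -(ler_pM2l rp); rewrite expr2 in fx; lra.
have [CA CA0 HA] := norm_mulmx_le A.
have [|||x0 [Cx0 fx0] xmin] := @exists_min R _ f S
    (2 * kappa + (CA * (2 * kappa) + 2 * kappa)) _ _ _ cf.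
- by exists 0; split; rewrite /= ?linear0// f0.
- apply: closedI; last exact: closed_le0.
  apply: (@closed_comp _ _ (@rsubmx R 1 N M) C) => //.
  by move=> x _; exact: continuous_rsubmx.
- move=> x Sx; have [h1 h2] := Sest x Sx.
  have r0 := enorm_ge0 (rr x).
  have h3 : enorm (rr x) <= 2 * kappa.
    by apply: le_trans h1; rewrite ler_peMr.
  have h4 : `|lsubmx x| <= 2 * kappa.
    rewrite -(@ler_pXn2r _ 2)// ?nnegrE ?mulr_ge0//.
    apply: le_trans (norm_sq_le_dotp _) _; apply: le_trans h2 _.
    by rewrite expr2 ler_wpM2l// mulr_ge0.
  apply: le_trans (norm_row_mx_le _) _; apply: lerD => //.
  have -> : rsubmx x = lsubmx x *m A - rr x by rewrite /rr opprB addrC subrK.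
  apply: le_trans (ler_normB _ _) _; apply: lerD.
    by apply: le_trans (HA _) _; rewrite ler_wpM2l// ltW.
  exact: le_trans (norm_le_enorm _) h3.
have gmin x : C (rsubmx x) -> f x0 <= f x.
  move=> Cx; have [fx|fx] := leP (f x) 0; first exact: xmin.
  exact: le_trans fx0 (ltW fx).
have [h1 h2] := Sest x0 (conj Cx0 fx0).
pose d := lsubmx x0; pose y := rsubmx x0; pose r := d *m A - y.
have rE : rr x0 = r by [].
rewrite rE -/d in h1 h2.
exists y, (k *: r); split=> //.
- have -> : k *: r = - (0 + k *: (y - d *m A)).
    by rewrite add0r -scalerN opprB.
  apply: (@polar_tangent_of_min R M C 0 (d *m A) k 1) => //; first exact: ltW.
  move=> y' _ Cy'; have := gmin (row_mx d y'); rewrite row_mxKr => /(_ Cy').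
  rewrite /f rE -/d /rr row_mxKl row_mxKr !dotp0l !add0r.
  have N1 (a b : 'rV[R]_M) : dotp (a - b) (a - b) = dotp (b - a) (b - a).
    by rewrite -opprB dotpNl dotpNr opprK.
  rewrite /r (N1 _ y) (N1 _ y'); lra.
- by rewrite enormZ ?(ltW kgt0)// mulrC.
(* The gradient of [f] in [d]. A step [- t G] cannot decrease [f], so [dotp G G] is at most a fixed
   multiple of [t] for every [t > 0]. *)
- pose G := c + d + k *: r *m A^T.
  have GE : dotp G G = dotp c G + dotp d G + k * dotp r (G *m A).
    have -> : dotp r (G *m A) = dotp (r *m A^T) G by rewrite dotpM trmxK.
    by rewrite {1}/G -scalemxAl !dotpDl (dotpZl k).
  have G0 : dotp G G <= 0.
    pose Q := dotp G G + k * dotp (G *m A) (G *m A).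
    have Q0 : 0 <= Q by rewrite addr_ge0 ?dotp_ge0// mulr_ge0 ?dotp_ge0// ltW.
    have Ht t : 0 < t -> dotp G G <= t / 2 * Q.
      move=> t0; have := gmin (row_mx (d - t *: G) y); rewrite row_mxKr => /(_ Cx0).
      rewrite /f rE -/d /rr row_mxKl row_mxKr.
      have -> : (d - t *: G) *m A - y = r - t *: (G *m A).
        by rewrite mulmxBl -scalemxAl /r addrAC.
      have sq n (a b : 'rV[R]_n) : dotp (a - t *: b) (a - t *: b) =
          dotp a a - 2 * t * dotp a b + t ^+ 2 * dotp b b.
        rewrite !(dotpDl, dotpDr, dotpNl, dotpNr) !(dotpZl t) !(dotpZr t).
        by rewrite (dotpC b a); ring.
      have cd (a b : 'rV[R]_N) : dotp c (a - t *: b) = dotp c a - t * dotp c b.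
        by rewrite dotpDr dotpNr (dotpZr t).
      rewrite (sq _ r) (sq _ d) cd => h.
      rewrite -(ler_pM2l t0) {1}GE /Q; lra.
    apply/ler_addgt0Pr => e' e'0; rewrite add0r.
    have w0 : 0 < e' / (Q + 1) by rewrite divr_gt0// ltr_wpDl.
    apply: le_trans (Ht _ w0) _; have := mulr_ge0 (ltW w0) Q0.
    have : e' = e' / (Q + 1) * (Q + 1) by rewrite divfK// gt_eqF// ltr_wpDl.
    move: (e' / (Q + 1)) w0 => w w0; lra.
  have GZ : c + k *: r *m A^T = - d.
    apply/eqP; rewrite -addr_eq0 addrAC -/G; exact/eqP/dotp_self_eq0.
  rewrite GZ normrN -(@ler_pXn2r _ 2)// ?nnegrE ?(ltW e0)//.
  apply: le_trans (norm_sq_le_dotp _) _; apply: le_trans h2 _.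
  have h3 : 2 * kappa * enorm r * k <= e ^+ 2 * k.
    apply: (@le_trans _ _ (2 * kappa * (2 * kappa))).
      by rewrite -mulrA ler_wpM2l// mulr_ge0.
    have -> : e ^+ 2 * k = 4 * kappa ^+ 2 + e ^+ 2.
      by rewrite /k; field; rewrite gt_eqF.
    have := sqr_ge0 e; rewrite !expr2; lra.
  by rewrite ler_pM2r in h3.
Qed.

End Penalty.

(** * Polyhedral cones and their critical cones *)

Section Polyhedral.
Context {R : realType} {J : finType} {m : nat}.
Variable a : J -> 'rV[R]_m.

Definition polycone : set 'rV[R]_m := [set v | forall j, dotp (a j) v <= 0].

(** Constraints that are strict at [v] leave room for a whole initial segment, so linearised
    directions are exactly feasible and not merely approximated. *)
Lemma polycone_ray v w : polycone v ->
  (forall j, dotp (a j) v = 0 -> dotp (a j) w <= 0) ->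
  exists2 d, 0 < d & forall t, 0 < t -> t < d -> polycone (v + t *: w).
Proof.
move=> Kv aw.
have [d d0 Hd] : exists2 d, 0 < d & forall j t, 0 < t -> t < d ->
    dotp (a j) (v + t *: w) <= 0.
  apply: uniform_radius => [j d d' _ d'd Hd t t0 td|j].
    by apply: Hd => //; exact: lt_le_trans d'd.
  have [E|E] := eqVneq (dotp (a j) v) 0.
    exists 1 => // t t0 _; rewrite dotpDr (dotpZr t) E add0r.
    by rewrite mulr_ge0_le0 ?aw// ltW.
  have v0 : 0 < - dotp (a j) v by rewrite oppr_gt0 lt_neqAle E Kv.
  pose K := `|dotp (a j) w| + 1; have K0 : 0 < K by rewrite ltr_wpDl.
  exists (- dotp (a j) v / K) => [|t t0]; first by rewrite divr_gt0.
  rewrite ltr_pdivlMr// => tK; rewrite dotpDr (dotpZr t).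
  have := ler_wpM2l (ltW t0) (ler_norm (dotp (a j) w)).
  rewrite /K in tK; lra.
by exists d => // t t0 td j; exact: Hd.
Qed.

Lemma tangent_polycone v w : polycone v ->
  tangent_cone polycone v w <-> (forall j, dotp (a j) v = 0 -> dotp (a j) w <= 0).
Proof.
move=> Kv; split=> [Tw j av|aw].
  by apply: tangent_halfspace av Tw => u; exact.
have [d d0 Hd] := polycone_ray Kv aw.
exact: tangent_cone_ray d0 Hd.
Qed.

Lemma rnormal_polycone v z :
  (forall u, polycone u -> dotp z u <= 0) -> dotp z v = 0 -> polycone v ->
  rnormal polycone v z.
Proof.
by move=> zK zv Kv; split=> // w; exact: tangent_halfspace.
Qed.

Definition face_cone (I1 I2 : {set J}) : set 'rV[R]_m :=
  [set w | (forall j, j \in I1 -> dotp (a j) w <= 0) /\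
           (forall j, j \in I2 -> dotp (a j) w = 0)].

(* Hence the critical cones of [polycone a] take finitely many values. *)
Lemma crit_polycone v z : polycone v ->
  (forall u, polycone u -> dotp z u <= 0) -> dotp z v = 0 ->
  exists I1 I2, crit_cone polycone v z = face_cone I1 I2.
Proof.
move=> Kv zK zv; have [y y0 zE] := farkas zK.
(* The constraints active at [v], and the support of a Farkas representation of [z]. The support
   consists of active constraints, and on tangent directions orthogonality to [z] is a vanishing sum
   of nonpositive terms, so it holds term by term. *)
exists [set j | dotp (a j) v == 0]%SET, [set j | 0 < y j]%SET.
have zx (x : 'rV[R]_m) : dotp z x = \sum_j y j * dotp (a j) x.
  by rewrite zE dotp_suml; apply: eq_bigr => j _; rewrite dotpZl.
have null (x : 'rV[R]_m) : (forall j, y j * dotp (a j) x <= 0) -> dotp z x = 0 ->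
    forall j, 0 < y j -> dotp (a j) x = 0.
  move=> le0; rewrite zx => /eqP; rewrite -oppr_eq0 -sumrN psumr_eq0 => [|j _].
    move=> /allP H j yj; have := H j (mem_index_enum j).
    by rewrite /= oppr_eq0 mulf_eq0 gt_eqF// => /eqP.
  by rewrite oppr_ge0.
have av : forall j, 0 < y j -> dotp (a j) v = 0.
  by apply: null => // j; rewrite mulr_ge0_le0.
apply/seteqP; split=> w /=.
  move=> [/(tangent_polycone _ Kv) Tw zw]; split=> j; rewrite inE.
    by move=> /eqP; exact: Tw.
  apply: null => // i; have := y0 i; rewrite le_eqVlt => /orP[/eqP<-|yi].
    by rewrite mul0r.
  by rewrite mulr_ge0_le0//; apply: Tw; exact: av.
move=> [h1 h2]; split.
  by apply/(tangent_polycone _ Kv) => j /eqP ajv; apply: h1; rewrite inE.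
rewrite /orth /= zx big1// => j _; have := y0 j; rewrite le_eqVlt => /orP[/eqP<-|yi].
  by rewrite mul0r.
by rewrite h2 ?mulr0// inE.
Qed.

End Polyhedral.

(** * Normals to the sheared graph and exact multipliers *)

Section PolyhedralMultiplier.
Context {R : realType} {J : finType} {m p N : nat}.
Variables (a : J -> 'rV[R]_m) (act : pred 'I_p) (S : 'M[R]_m).

Definition act_cone : set 'rV[R]_p := [set s | forall i, act i -> s ord0 i <= 0].

Definition residual (r : 'rV[R]_(m + m + p)) : 'rV[R]_m :=
  rsubmx (lsubmx r) - lsubmx (lsubmx r) *m S.

(* The image of the graph of the normal cone to [polycone a] under the shear
   (v, z) |-> (v, v S + z), times [act_cone] *)
Definition sheared_graph : set 'rV[R]_(m + m + p) :=
  [set r | [/\ polycone a (lsubmx (lsubmx r)),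
      forall u, polycone a u -> dotp (residual r) u <= 0,
      dotp (residual r) (lsubmx (lsubmx r)) = 0 & act_cone (rsubmx r)]].

Lemma sheared_graph_row v z s : sheared_graph (row_mx (row_mx v (v *m S + z)) s) <->
  [/\ polycone a v, forall u, polycone a u -> dotp z u <= 0, dotp z v = 0 &
      act_cone s].
Proof.
rewrite /sheared_graph /residual /= !row_mxKl !row_mxKr.
by rewrite [v *m S + z]addrC addrK.
Qed.

Let cV : continuous (fun r : 'rV[R]_(m + m + p) => lsubmx (lsubmx r) : 'rV[R]_m).
Proof.
exact: (continuous_rV_comp (@continuous_lsubmx R m m) (@continuous_lsubmx R _ p)).
Qed.

Let cres : continuous residual.
Proof.
apply: continuous_rV_sub; last by apply: continuous_mulmxr; exact: cV.
exact: (continuous_rV_comp (@continuous_rsubmx R m m) (@continuous_lsubmx R _ p)).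
Qed.

Lemma closed_sheared_graph : closed sheared_graph.
Proof.
have -> : sheared_graph =
    (\bigcap_j [set r | dotp (a j) (lsubmx (lsubmx r)) <= 0]) `&`
    (\bigcap_(u in polycone a) [set r | dotp (residual r) u <= 0]) `&`
    ([set r | dotp (residual r) (lsubmx (lsubmx r)) <= 0] `&`
     [set r | - 1 * dotp (residual r) (lsubmx (lsubmx r)) <= 0]) `&`
    (\bigcap_(i in act) [set r | dotp (rsubmx r) (delta_mx ord0 i) <= 0]).
  apply/seteqP; split=> r /=.
    move=> [h1 h2 h3 h4]; split; [split; [split|]|].
    - by move=> j _; exact: h1.
    - by move=> u; exact: h2.
    - by rewrite h3 mulr0.
    - by move=> i ai /=; rewrite dotp_delta h4.
  move=> [[[h1 h2] [h3 h3']] h4]; split.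
  - by move=> j; exact: h1.
  - by move=> u; exact: h2.
  - by apply/eqP; rewrite eq_le h3 /=; lra.
  - by move=> i ai; have := h4 i ai; rewrite /= dotp_delta.
have cc k (x : 'rV[R]_k) : continuous (fun _ : 'rV[R]_(m + m + p) => x).
  exact: cst_continuous.
apply: closedI; [apply: closedI; [apply: closedI|apply: closedI]|].
- apply: closed_bigI => j _; apply: closed_le0.
  exact: (continuous_dotp (cc _ (a j)) cV).
- apply: closed_bigI => u _; apply: closed_le0.
  exact: (continuous_dotp cres (cc _ u)).
- by apply: closed_le0; exact: (continuous_dotp cres cV).
- apply: closed_le0; apply: continuous_real_scale.
  exact: (continuous_dotp cres cV).
- apply: closed_bigI => i _; apply: closed_le0.
  exact: (continuous_dotp (@continuous_rsubmx _ _ _) (cc _ (delta_mx ord0 i))).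
Qed.

(** The normal is tested on segments inside the graph: adding an active [a j] to [z], rescaling [z],
    moving [v] in a critical direction with [z] fixed, and moving [s]. In the third family the shear
    sends [w] to [(w, w S)], whence [n2 *m S^T]. *)
Lemma normal_sheared_graph v z s n1 n2 mu :
  sheared_graph (row_mx (row_mx v (v *m S + z)) s) ->
  polar (tangent_cone sheared_graph (row_mx (row_mx v (v *m S + z)) s))
    (row_mx (row_mx n1 n2) mu) ->
  [/\ crit_cone (polycone a) v z n2,
      polar (crit_cone (polycone a) v z) (n1 + n2 *m S^T) &
      forall s', act_cone s' -> dotp mu s' <= 0].
Proof.
move=> Hr Hn; have [Kv zK zv ss] := (sheared_graph_row _ _ _).1 Hr.
have ray d w1 w2 s' : 0 < d -> (forall t, 0 < t -> t < d ->
    sheared_graph (row_mx (row_mx (v + t *: w1) ((v + t *: w1) *m S + (z + t *: w2)))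
      (s + t *: s'))) ->
    dotp n1 w1 + dotp n2 (w1 *m S + w2) + dotp mu s' <= 0.
  move=> d0 H; rewrite -!dotp_row_mx; apply: Hn; apply: (tangent_cone_ray d0).
  move=> t t0 td; have := H t t0 td; congr sheared_graph.
  rewrite !scale_row_mx !add_row_mx; congr (row_mx (row_mx _ _) _).
  by rewrite mulmxDl -scalemxAl scalerDr addrACA.
have pos t : 0 < t -> forall s', act_cone s' -> act_cone (s + t *: s').
  move=> t0 s' ss' i ai; rewrite !mxE; have := ss i ai.
  have := mulr_ge0_le0 (ltW t0) (ss' i ai); lra.
split; first split.
- apply/(tangent_polycone _ Kv) => j av.
  have := ray 1 0 (a j) 0 ltr01; rewrite mul0mx add0r !dotp0r addr0 add0r dotpC.
  apply=> t t0 _; rewrite !scaler0 !addr0; apply/sheared_graph_row; split=> //.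
    move=> u Ku; rewrite dotpDl (dotpZl t); have := zK u Ku.
    have := mulr_ge0_le0 (ltW t0) (Ku j); lra.
  by rewrite dotpDl (dotpZl t) zv av mulr0 addr0.
(* Both signs of [c] are used; for [t < 1] the factor [1 + t * c] stays nonnegative, so the rescaled
   vector remains normal. *)
- have Hz c : `|c| <= 1 -> c * dotp n2 z <= 0.
    move=> c1; have := ray 1 0 (c *: z) 0 ltr01.
    rewrite mul0mx add0r !dotp0r addr0 add0r dotpZr; apply=> t t0 t1.
    rewrite !scaler0 !addr0; apply/sheared_graph_row.
    have -> : z + t *: (c *: z) = (1 + t * c) *: z by rewrite scalerA scalerDl scale1r.
    split=> //; last by rewrite dotpZl zv mulr0.
    move=> u Ku; rewrite dotpZl mulr_ge0_le0 ?zK//.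
    move: c1; rewrite ler_norml => /andP[c1 _]; nra.
  have := Hz 1; have := Hz (-1); rewrite normrN normr1.
  move=> /(_ (lexx _)) h1 /(_ (lexx _)) h2; rewrite /orth /= dotpC.
  by apply/eqP; rewrite eq_le; apply/andP; split; lra.
- move=> w [/(tangent_polycone _ Kv) Tw zw].
  have [d d0 Hd] := polycone_ray Kv Tw.
  have := ray d w 0 0 d0; rewrite dotp0r !addr0 => H.
  rewrite dotpDl dotpM trmxK; apply: H => t t0 td.
  rewrite !scaler0 !addr0; apply/sheared_graph_row; split=> //; first exact: Hd.
  by rewrite dotpDr (dotpZr t) zv zw mulr0 addr0.
- move=> s' ss'; have := ray 1 0 0 s' ltr01.
  rewrite mul0mx addr0 !dotp0r !add0r; apply=> t t0 _.
  rewrite !scaler0 !addr0; apply/sheared_graph_row; split=> //.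
  exact: pos.
Qed.

(** The conclusions of [normal_sheared_graph] with the critical cone replaced by a face cone: the
    base point has disappeared, and what remains is closed in [nu]. *)
Let P (I : {set J} * {set J}) : set 'rV[R]_(m + m + p) :=
  [set nu | [/\ face_cone a I.1 I.2 (rsubmx (lsubmx nu)),
     polar (face_cone a I.1 I.2) (lsubmx (lsubmx nu) + rsubmx (lsubmx nu) *m S^T) &
     forall s', act_cone s' -> dotp (rsubmx nu) s' <= 0]].

Let closedP I : closed (P I).
Proof.
have cR : continuous (fun r : 'rV[R]_(m + m + p) => rsubmx (lsubmx r) : 'rV[R]_m).
  exact: (continuous_rV_comp (@continuous_rsubmx R m m) (@continuous_lsubmx R _ p)).
have cc k (x : 'rV[R]_k) : continuous (fun _ : 'rV[R]_(m + m + p) => x).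
  exact: cst_continuous.
have -> : P I =
    (\bigcap_(j in [set` I.1]) [set r | dotp (a j) (rsubmx (lsubmx r)) <= 0]) `&`
    (\bigcap_(j in [set` I.2]) [set r | dotp (a j) (rsubmx (lsubmx r)) <= 0]) `&`
    (\bigcap_(j in [set` I.2]) [set r | dotp (- a j) (rsubmx (lsubmx r)) <= 0]) `&`
    (\bigcap_(u in face_cone a I.1 I.2) [set r | dotp (lsubmx (lsubmx r)) u +
       dotp (rsubmx (lsubmx r)) (u *m S) <= 0]) `&`
    (\bigcap_(s' in act_cone) [set r | dotp (rsubmx r) s' <= 0]).
  apply/seteqP; split=> r /=.
    move=> [[h1 h2] h3 h4]; split; [split; [split; [split|]|]|].
    - by move=> j; exact: h1.
    - by move=> j /h2 /= ->.
    - by move=> j /h2 /=; rewrite dotpNl => ->; rewrite oppr0.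
    - by move=> u /h3; rewrite dotpDl dotpM trmxK.
    - by move=> s'; exact: h4.
  move=> [[[[h1 h2] h2'] h3] h4]; split=> //; first split.
  - by move=> j; exact: h1.
  - move=> j jI; apply/eqP; rewrite eq_le (h2 j jI) /=.
    by have := h2' j jI; rewrite /= dotpNl oppr_le0.
  - by move=> u /h3; rewrite dotpDl dotpM trmxK.
apply: closedI; [apply: closedI; [apply: closedI; [apply: closedI|]|]|].
- apply: closed_bigI => j _; apply: closed_le0.
  exact: (continuous_dotp (cc _ (a j)) cR).
- apply: closed_bigI => j _; apply: closed_le0.
  exact: (continuous_dotp (cc _ (a j)) cR).
- apply: closed_bigI => j _; apply: closed_le0.
  exact: (continuous_dotp (cc _ (- a j)) cR).
- apply: closed_bigI => u _; apply: closed_le0; apply: continuous_real_add.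
    exact: (continuous_dotp cV (cc _ u)).
  exact: (continuous_dotp cR (cc _ (u *m S))).
- apply: closed_bigI => s' _; apply: closed_le0.
  exact: (continuous_dotp (@continuous_rsubmx _ _ _) (cc _ s')).
Qed.

(** Without an exact multiplier, the defect would have a positive minimum over the compact set of
    bounded normals of each realised face cone for which that set is nonempty. Finitely many cones
    give a common positive lower bound, against the approximate multipliers. *)
Lemma polyhedral_multiplier (A : 'M[R]_(N, m + m + p)) (c : 'rV[R]_N) kappa :
  0 <= kappa ->
  (forall d y, sheared_graph y -> - (kappa * enorm (d *m A - y)) <= dotp c d) ->
  exists v z n1 n2 mu,
    [/\ polycone a v, rnormal (polycone a) v z, crit_cone (polycone a) v z n2,
        polar (crit_cone (polycone a) v z) (n1 + n2 *m S^T) &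
        (forall s', act_cone s' -> dotp mu s' <= 0) /\
        c + row_mx (row_mx n1 n2) mu *m A^T = 0].
Proof.
move=> k0 Hc.
(* Membership in [P I] forgets [v] and [z]; this records that some pair has that critical cone, so
   that one can be restored at the end. *)
pose realized I := exists v z, [/\ polycone a v, rnormal (polycone a) v z &
  crit_cone (polycone a) v z = face_cone a I.1 I.2].
have C0 : sheared_graph 0.
  have -> : 0 = row_mx (row_mx 0 (0 *m S + 0)) 0 :> 'rV[R]_(m + m + p).
    by rewrite mul0mx addr0 !row_mx0.
  apply/sheared_graph_row.
  by split=> [j|u _||i _]; rewrite ?dotp0r ?dotp0l ?mxE.
have approx e : 0 < e -> exists I nu, [/\ realized I, P I nu, enorm nu <= 2 * kappa &
    `|c + nu *m A^T| <= e].
  move=> e0.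
  have [y [nu [Cy Ny nuk nue]]] := approx_multiplier closed_sheared_graph C0 k0 Hc e0.
  pose v := lsubmx (lsubmx y); pose z := residual y.
  have yE : y = row_mx (row_mx v (v *m S + z)) (rsubmx y).
    by rewrite /v /z /residual addrC subrK !hsubmxK.
  have nuE : nu = row_mx (row_mx (lsubmx (lsubmx nu)) (rsubmx (lsubmx nu))) (rsubmx nu).
    by rewrite !hsubmxK.
  rewrite yE in Cy Ny; rewrite nuE in Ny.
  have [n2 n1 mu0] := normal_sheared_graph Cy Ny.
  have [Kv zK zv _] := (sheared_graph_row _ _ _).1 Cy.
  have [I1 [I2 IE]] := crit_polycone Kv zK zv.
  exists (I1, I2), nu; split=> //.
    by exists v, z; split=> //; exact: rnormal_polycone.
  by rewrite IE in n1 n2.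
suff [I [nu [[v [z [Kv Nz IE]]] [n2 n1 mu0] E]]] : exists I nu,
    [/\ realized I, P I nu & c + nu *m A^T = 0].
  exists v, z, (lsubmx (lsubmx nu)), (rsubmx (lsubmx nu)), (rsubmx nu).
  by rewrite !hsubmxK IE.
apply: contrapT => nex.
have [d d0 Hd] : exists2 d, 0 < d & forall I, ~ (realized I /\ exists nu,
    [/\ P I nu, enorm nu <= 2 * kappa & `|c + nu *m A^T| <= d]).
  apply: uniform_radius => [I d d' _ d'd H [rI [nu [h1 h2 h3]]]|I].
    by apply: H; split=> //; exists nu; split=> //; exact: le_trans d'd.
  have [rI|nrI] := pselect (realized I); last by exists 1 => // -[].
  pose B := P I `&` [set nu | `|nu| <= 2 * kappa].
  have [B0|nB] := pselect (B !=set0); last first.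
    exists 1 => // -[_ [nu [h1 h2 h3]]]; apply: nB; exists nu; split=> //=.
    exact: le_trans (norm_le_enorm _) h2.
  pose f (nu : 'rV[R]_(m + m + p)) := `|c + nu *m A^T|.
  have cf : continuous f.
    have -> : f = fun nu => `|nu *m A^T - (- c)|.
      by apply/funext => nu; rewrite opprK addrC.
    apply: continuous_rV_norm; apply: continuous_rV_sub.
      exact: continuous_mulmx.
    exact: cst_continuous.
  have cB : closed B.
    apply: closedI; first exact: closedP.
    have -> : [set nu : 'rV[R]_(m + m + p) | `|nu| <= 2 * kappa] =
        [set nu | `|nu| + (- (2 * kappa)) <= 0].
      by apply/seteqP; split=> nu /=; rewrite subr_le0.
    apply: closed_le0; apply: continuous_real_add; last exact: cst_continuous.
    by apply: continuous_rV_norm; exact: continuous_rV_id.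
  have [nu [Pnu nuk] numin] := exists_min B0 cB (fun _ h => h.2) cf.
  have fnu : 0 < f nu.
    rewrite lt_neqAle normr_ge0 andbT eq_sym normr_eq0; apply/eqP => E.
    by apply: nex; exists I, nu.
  exists (f nu / 2); first by rewrite divr_gt0.
  move=> [_ [nu' [h1 h2 h3]]]; have := numin nu' (conj h1 _).
  move=> /(_ (le_trans (norm_le_enorm _) h2)) h4.
  have : f nu <= f nu / 2 by apply: le_trans h4 h3.
  lra.
have [I [nu [rI h1 h2 h3]]] := approx d d0.
by apply: (Hd I); split=> //; exists nu.
Qed.

End PolyhedralMultiplier.

(** * Linearisation of the equilibrium constraints *)

Section Assembly.
Context {R : realType}.

Lemma quad_dotp k (v : 'rV[R]_k) (M : 'M[R]_k) :
  (v *m M *m v^T) ord0 ord0 = dotp (v *m M) v.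
Proof. by rewrite mxE; apply: eq_bigr => i _; rewrite [v^T _ _]mxE. Qed.

Lemma tangent_orthant k (s w : 'rV[R]_k) : nonpos_orthant s ->
  tangent_cone nonpos_orthant s w <-> act_cone (fun i => s ord0 i == 0) w.
Proof.
have -> : nonpos_orthant = polycone (fun i => delta_mx ord0 i : 'rV[R]_k).
  by apply/seteqP; split=> x h i; have := h i; rewrite dotpC dotp_delta.
move=> s0; rewrite (tangent_polycone _ s0); split=> h i.
  by move=> /eqP si; have := h i; rewrite ![dotp (delta_mx _ _) _]dotpC !dotp_delta; apply.
by rewrite ![dotp (delta_mx _ _) _]dotpC !dotp_delta => /eqP; exact: h.
Qed.

(** Multiples of unit vectors serve as tests: the coefficient -1 gives the sign, and 1, tangent
    where the constraint is inactive, gives complementarity. *)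
Lemma rnormal_orthant k (s lam : 'rV[R]_k) : nonpos_orthant s ->
  rnormal nonpos_orthant s lam <->
  (forall i, 0 <= lam ord0 i) /\ (forall i, lam ord0 i * s ord0 i = 0).
Proof.
move=> s0; split=> [[_ Hlam]|[lam0 lams]].
  have D c i : (s ord0 i == 0 -> c <= 0) -> lam ord0 i * c <= 0.
    move=> h; have := Hlam (c *: delta_mx ord0 i).
    rewrite dotpZr dotp_delta mulrC; apply; apply/(tangent_orthant _ s0) => j sj.
    rewrite !mxE eqxx /=; case: eqP => [ji|_]; last by rewrite mulr0.
    by rewrite mulr1 h// -ji.
  have lam0 i : 0 <= lam ord0 i.
    by have := D (-1) i (fun=> lerN10 _); rewrite mulrN mulr1 oppr_le0.
  split=> // i; have [->|si] := eqVneq (s ord0 i) 0; first by rewrite mulr0.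
  have : lam ord0 i * 1 <= 0 by apply: D => E; rewrite E in si.
  rewrite mulr1 => h; have -> : lam ord0 i = 0 by apply/eqP; rewrite eq_le h lam0.
  by rewrite mul0r.
split=> // w /(tangent_orthant _ s0) Tw; apply: sumr_le0 => i _.
have [si|si] := boolP (s ord0 i == 0); first by rewrite mulr_ge0_le0// Tw.
have /eqP := lams i; rewrite mulf_eq0 (negPf si) orbF => /eqP ->.
by rewrite mul0r.
Qed.

Lemma C1_differentiable k l (f : 'rV[R]_k -> 'rV[R]_l) :
  C1 f -> forall x : 'rV[R]_k, differentiable f x.
Proof. by move=> [D _] x; exact (D x). Qed.

Lemma jac_Phat n m p (phi : 'rV[R]_(n + m) -> 'rV[R]_m)
    (G : 'rV[R]_(n + m) -> 'rV[R]_p) (z : 'rV[R]_(n + m)) :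
  differentiable phi z -> differentiable G z ->
  jac (Phat phi G) z =
    row_mx (row_mx (col_mx 0 1%:M) (- jac phi z)) (jac G z).
Proof.
move=> Dphi DG; apply: (jac_approx _).2 => e e0.
have e2 : 0 < e / 2 by rewrite divr_gt0.
have [d1 d10 H1] := differentiable_approx Dphi e2.
have [d2 d20 H2] := differentiable_approx DG e2.
exists (Num.min d1 d2); first by rewrite lt_min d10.
move=> h; rewrite lt_min => /andP[hd1 hd2].
have := H1 h hd1; have := H2 h hd2; rewrite !diff_jac => E2 E1.
have -> : Phat phi G (z + h) - Phat phi G z -
    h *m row_mx (row_mx (col_mx 0 1%:M) (- jac phi z)) (jac G z) =
    row_mx (row_mx 0 (- (phi (z + h) - phi z - h *m jac phi z)))
      (G (z + h) - G z - h *m jac G z).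
  rewrite /Phat !mul_mx_row !opp_row_mx !add_row_mx; congr (row_mx (row_mx _ _) _).
    rewrite linearD -[in h *m _](hsubmxK h) mul_row_col mulmx0 mulmx1 add0r.
    by rewrite [rsubmx z + _]addrC addrK subrr.
  by rewrite mulmxN !opprD !opprK.
apply: le_trans (norm_row_mx_le _) _; rewrite row_mxKl row_mxKr.
have := norm_row_mx_le (row_mx (0 : 'rV[R]_m)
  (- (phi (z + h) - phi z - h *m jac phi z))).
rewrite row_mxKl row_mxKr normr0 add0r normrN => E3.
have : e * `|h| = e / 2 * `|h| + e / 2 * `|h| by field.
lra.
Qed.

Lemma sheared_graph_scale (J : finType) m p (a : J -> 'rV[R]_m) (act : pred 'I_p)
    (S : 'M[R]_m) t r :
  0 < t -> sheared_graph a act S r -> sheared_graph a act S (t *: r).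
Proof.
move=> t0 [h1 h2 h3 h4].
have vE : lsubmx (lsubmx (t *: r)) = t *: lsubmx (lsubmx r) by rewrite !linearZ.
have rE : residual S (t *: r) = t *: residual S r.
  by rewrite /residual vE !linearZ /= -scalemxAl scalerBr.
split; rewrite ?rE ?vE.
- by move=> j; rewrite (dotpZr t) pmulr_rle0.
- by move=> u /h2; rewrite (dotpZl t) pmulr_rle0.
- by rewrite (dotpZr t) (dotpZl t) h3 !mulr0.
- by move=> i ai; rewrite linearZ mxE pmulr_rle0// h4.
Qed.

Lemma entry_taylor1 m q (g : 'rV[R]_m -> 'rV[R]_q) y :
  (forall x : 'rV[R]_m, differentiable g x) ->
  forall i e, 0 < e -> exists2 d, 0 < d & forall h, `|h| < d ->
    `|g (y + h) ord0 i - g y ord0 i - dotp (grad (fun y => g y ord0 i) y) h|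
      <= e * `|h|.
Proof.
move=> Dg i e e0; have [Di _] := differentiable_entry i (Dg y).
have [d d0 Hd] := differentiable_approx Di e0.
by exists d => // h /Hd; rewrite diff_grad.
Qed.

Lemma entry_taylor2 m q (g : 'rV[R]_m -> 'rV[R]_q) y : C2 g ->
  forall i e, 0 < e -> exists2 d, 0 < d & forall h, `|h| < d ->
    `|g (y + h) ord0 i - g y ord0 i - dotp (grad (fun y => g y ord0 i) y) h -
      2^-1 * dotp (h *m hess (fun y => g y ord0 i) y) h| <= e * `|h| ^+ 2.
Proof.
move=> [C1g C2g] i; apply: taylor2.
  move=> x; have D := C1_differentiable C1g x.
  by have [] := differentiable_entry i D.
exact: C1_differentiable.
Qed.

End Assembly.

(** * The conic subset of the tangent cone for the actual data *)

Section Linearization.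
Context {R : realType} {n m p q : nat}.
Variables (phi : 'rV[R]_(n + m) -> 'rV[R]_m)
  (G : 'rV[R]_(n + m) -> 'rV[R]_p) (g : 'rV[R]_m -> 'rV[R]_q).
Variables (yb : 'rV[R]_m) (zb : 'rV[R]_(n + m)).

Let ys : 'rV[R]_m := - phi zb.
Let a i := grad (fun y => g y ord0 i) yb.
Let H i := hess (fun y => g y ord0 i) yb.

Lemma Lambda_bar_multiplier : C2 g -> Gamma g yb -> forall lam,
  Lambda_bar g yb ys lam <-> multiplier g yb a ys lam.
Proof.
move=> C2g Gyb lam.
have E : lam *m (jac g yb)^T = \sum_i lam ord0 i *: a i.
  rewrite mulmx_sum_row; apply: eq_bigr => i _; congr (_ *: _).
  apply/rowP => j; rewrite /a (differentiable_entry _ _).2; last first.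
    by apply: C1_differentiable; case: C2g.
  by rewrite !mxE.
rewrite /Lambda_bar /= E; split=> [[/(rnormal_orthant _ Gyb)[h1 h2] h3]|[h1 h2 h3]].
  by split.
by split=> //; apply/(rnormal_orthant _ Gyb).
Qed.

Lemma crit_Gamma : C2 g -> Gamma g yb ->
  metric_subregular (fun y => [set g y - s | s in nonpos_orthant]) yb 0 ->
  crit_cone (Gamma g) yb ys = polycone (critical_gens g yb a ys).
Proof.
move=> C2g Gyb /feasible_approx feas.
have Dg : forall x : 'rV[R]_m, differentiable g x.
  by apply: C1_differentiable; case: C2g.
apply/seteqP; split=> v.
  move=> [/(tangent_Gamma Gyb feas (entry_taylor1 yb Dg)) av ysv].
  exact/critical_gensP.
move=> /critical_gensP[av ysv]; split=> //.
exact/(tangent_Gamma Gyb feas (entry_taylor1 yb Dg)).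
Qed.

(** [normal_graph_approx] provides graph points for every small [t], and the ray in the polyhedral
    orthant is exactly feasible for small [t]; hence both factors of [Dhat] are approached with a
    common step. *)
Lemma sheared_graph_tangent lam : C2 g ->
  rnormal (Gamma g) yb ys ->
  metric_subregular (fun y => [set g y - s | s in nonpos_orthant]) yb 0 ->
  nonpos_orthant (G zb) -> rsubmx zb = yb -> Lambda_bar g yb ys lam ->
  (forall v l, crit_cone (Gamma g) yb ys v -> Lambda_bar g yb ys l ->
     dotp (v *m hess_lag g l yb) v <= dotp (v *m hess_lag g lam yb) v) ->
  sheared_graph (critical_gens g yb a ys) (fun i => G zb ord0 i == 0)
    (hess_lag g lam yb) `<=` tangent_cone (Dhat g) (Phat phi G zb).
Proof.
move=> C2g [Gyb _] subreg Gzb zby lamL lmax r.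
have KE := crit_Gamma C2g Gyb subreg.
have feas := feasible_approx subreg.
have Dg : forall x : 'rV[R]_m, differentiable g x.
  by apply: C1_differentiable; case: C2g.
have cg : continuous g.
  by move=> x; apply: differentiable_continuous; exact: (Dg x).
have lamM := (Lambda_bar_multiplier C2g Gyb lam).1 lamL.
have LagE l : hess_lag g l yb = \sum_i l ord0 i *: H i by exact: hess_lag_sum.
set S := hess_lag g lam yb; have SE : S = \sum_i lam ord0 i *: H i := LagE lam.
have Ssym : S^T = S.
  rewrite SE linear_sum; apply: eq_bigr => i _; rewrite linearZ /= /H hess_sym//.
    by move=> x; have [] := differentiable_entry i (Dg x).
  by case: C2g => _ /(_ i); move=> /C1_differentiable.
move=> Hr; pose v := lsubmx (lsubmx r); pose z := residual S r.
have rE : r = row_mx (row_mx v (v *m S + z)) (rsubmx r).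
  by rewrite /v /z /residual addrC subrK !hsubmxK.
have [Kv zK zv ss] := Hr.
have [av ysv] := (critical_gensP _ _ _ _ _).1 Kv.
have vmax l : multiplier g yb a ys l ->
    \sum_i l ord0 i * dotp (v *m H i) v <= \sum_i lam ord0 i * dotp (v *m H i) v.
  move=> lM.
  have E l' : dotp (v *m hess_lag g l' yb) v = \sum_i l' ord0 i * dotp (v *m H i) v.
    rewrite LagE mulmx_sumr dotp_suml; apply: eq_bigr => i _.
    by rewrite -scalemxAr dotpZl.
  rewrite -(E l) -(E lam); apply: lmax; first by rewrite KE.
  exact: (Lambda_bar_multiplier C2g Gyb l).2.
apply/tangent_coneP => e e0.
have e4 : 0 < e / 4 by rewrite divr_gt0.
have [d d0 Hd] := normal_graph_approx Gyb feas (entry_taylor1 yb Dg) (entry_taylor2 yb C2g)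
  lamM SE cg Ssym av ysv vmax zK zv e4.
have [d' d'0 Hd'] : exists2 d, 0 < d & forall t, 0 < t -> t < d ->
    nonpos_orthant (G zb + t *: rsubmx r).
  have E : nonpos_orthant = polycone (fun i => delta_mx ord0 i : 'rV[R]_p).
    by apply/seteqP; split=> x h i; have := h i; rewrite dotpC dotp_delta.
  rewrite E in Gzb *; apply: polycone_ray => // i; rewrite ![dotp (delta_mx _ _) _]dotpC.
  by rewrite !dotp_delta => /eqP; exact: ss.
pose t := Num.min (Num.min d d') e / 2.
have m0 : 0 < Num.min (Num.min d d') e by rewrite !lt_min d0 d'0.
have t0 : 0 < t by rewrite divr_gt0.
have : t < Num.min (Num.min d d') e by rewrite /t; lra.
rewrite !lt_min => /andP[/andP[td td'] te].
have [u [us [uv usv Gu Nu]]] := Hd t t0 td.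
exists t, (row_mx (row_mx u us) (rsubmx r)); split=> //.
  rewrite [in X in _ - X]rE !opp_row_mx !add_row_mx subrr.
  apply: le_lt_trans (norm_row_mx_le _) _; rewrite row_mxKl row_mxKr normr0 addr0.
  apply: le_lt_trans (norm_row_mx_le _) _; rewrite row_mxKl row_mxKr.
  apply: (@le_lt_trans _ _ (e / 4 + e / 4)); first exact: lerD.
  lra.
exists (row_mx (yb + t *: u) (ys + t *: us)), (G zb + t *: rsubmx r).
split; first by exists (yb + t *: u), (ys + t *: us).
split; first exact: Hd'.
by rewrite /Phat zby !scale_row_mx !add_row_mx.
Qed.

End Linearization.

(* Metric subregularity turns [c . d >= 0] on [{d | d A in T}] into an exact
   penalty bound for any conic subset of [T]. *)
Lemma subregular_penalty (R : realType) N M (A : 'M[R]_(N, M)) (T C : set 'rV[R]_M)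
    (c : 'rV[R]_N) :
  metric_subregular (fun d => [set d *m A - t | t in T]) 0 0 ->
  C `<=` T -> (forall t r, 0 < t -> C r -> C (t *: r)) ->
  (forall d, T (d *m A) -> 0 <= dotp c d) ->
  exists2 kappa, 0 <= kappa & forall d y, C y ->
    - (kappa * enorm (d *m A - y)) <= dotp c d.
Proof.
move=> /subregular_approx[k [del [k0 del0 Hk]]] CT Cscale cT.
pose K : R := N%:R * `|c|; have K0 : 0 <= K by rewrite mulr_ge0.
exists (K * k) => [|d y Cy]; first by rewrite mulr_ge0// ltW.
have D0 : 0 < `|d| + 1 by rewrite ltr_wpDl.
(* Scales [d] into the neighbourhood of subregularity. Both sides of the claim are positively
   homogeneous and [C] is a cone, so the local bound becomes global. *)
pose t := del / (`|d| + 1); have t0 : 0 < t by rewrite divr_gt0.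
have td : `|t *: d - 0| < del.
  by rewrite subr0 normrZ gtr0_norm// /t mulrAC ltr_pdivrMr// ltr_pM2l// ltrDl.
rewrite -(ler_pM2l t0); apply/ler_addgt0Pr => e e0.
have e1 : 0 < e / (K + 1) by rewrite divr_gt0// ltr_wpDl.
have [|d' [s Ts /eqP]] := Hk _ ((t *: d) *m A - t *: y) _ td _ e1.
  by exists (t *: y) => //; apply: CT; exact: Cscale.
rewrite subr_eq0 => /eqP d's; rewrite sub0r -scalemxAl -scalerBr enormN enormZ ?(ltW t0)//.
move=> lt; have h1 : 0 <= dotp c d' by apply: cT; rewrite d's.
have h2 : - dotp c (t *: d - d') <= K * enorm (t *: d - d').
  apply: le_trans (ler_norm _) _; rewrite normrN; apply: le_trans (dotp_le_norm _ _) _.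
  by rewrite ler_wpM2l// norm_le_enorm.
have h3 := ler_wpM2l K0 (ltW lt).
have h4 : K * (e / (K + 1)) <= e.
  have := mulr_ge0 K0 (ltW e1).
  have : e = (K + 1) * (e / (K + 1)) by rewrite mulrCA divff ?mulr1// gt_eqF// ltr_wpDl.
  move: (e / (K + 1)) e1 => w w0; lra.
rewrite dotpDr dotpNr (dotpZr t) in h2; lra.
Qed.

Unset Implicit Arguments.

Theorem theorem5p3 (R : realType) (n m p q : nat)
  (F : 'rV[R]_(n + m) -> R) (phi : 'rV[R]_(n + m) -> 'rV[R]_m)
  (G : 'rV[R]_(n + m) -> 'rV[R]_p) (g : 'rV[R]_m -> 'rV[R]_q)
  (xb : 'rV[R]_n) (yb : 'rV[R]_m) :
  C1s F -> C1 phi -> C1 G -> C2 g ->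
  B_stationary F phi G g (row_mx xb yb) ->
  metric_subregular (fun y => [set g y - s | s in nonpos_orthant]) yb 0 ->
  GGCQ phi G g (row_mx xb yb) ->
  metric_subregular
    (fun d : 'rV[R]_(n + m) =>
       [set d *m jac (Phat phi G) (row_mx xb yb) - t
       | t in tangent_cone (Dhat g) (Phat phi G (row_mx xb yb))]) 0 0 ->
  let zb := row_mx xb yb in
  let ys := - phi zb in
  let Kb := crit_cone (Gamma g) yb ys in
  forall Lt : set 'rV[R]_q,
    Lt `<=` Lambda_bar g yb ys ->
    (forall v, Kb v -> v != 0 -> Lambda_bar_v g yb ys v = Lt) ->
  forall lt, Lt lt ->
  exists v zs w mu,
    [/\ Kb v, rnormal Kb v zs, crit_cone Kb v zs w,
        rnormal nonpos_orthant (G zb) mu &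
        (
        0 = lsubmx (grad F zb) - w *m (usubmx (jac phi zb))^T
              + mu *m (usubmx (jac G zb))^T) /\
        (exists2 eta, polar (crit_cone Kb v zs) eta &
        0 = rsubmx (grad F zb) - w *m (hess_lag g lt yb)^T
              - w *m (dsubmx (jac phi zb))^T
              + mu *m (dsubmx (jac G zb))^T + eta)].
Proof.
move=> _ C1phi C1G C2g [xi xiN Fxi] subreg ggcq subreg2 zb ys Kb Lt LtL LtE lt Ltlt.
have zby : rsubmx zb = yb by rewrite /zb row_mxKr.
have [[u [s [[y' [w' [Nys uE]]] [s0 PE]]]] _] := xiN.
have [yE wE sE] : [/\ y' = yb, w' = ys & s = G zb].
  move: PE; rewrite uE /Phat -/zb => /eq_row_mx[/eq_row_mx[E1 E2] E3].
  by split; rewrite // -E1.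
rewrite {y'}yE {w'}wE in Nys uE; rewrite {s}sE in s0 PE.
have Gyb : Gamma g yb by case: Nys.
have ltL := LtL lt Ltlt.
pose a i := grad (fun y => g y ord0 i) yb.
have KE : Kb = polycone (critical_gens g yb a ys).
  exact: crit_Gamma.
have lmax v l : Kb v -> Lambda_bar g yb ys l ->
    dotp (v *m hess_lag g l yb) v <= dotp (v *m hess_lag g lt yb) v.
  move=> Kv lL.
  have q0 (M1 M2 : 'M[R]_m) : dotp (0 *m M1) 0 <= dotp (0 *m M2) 0.
    by rewrite !dotp0r.
  have qv (M1 M2 : 'M[R]_m) : (v *m M1 *m v^T) ord0 ord0 <=
      (v *m M2 *m v^T) ord0 ord0 -> dotp (v *m M1) v <= dotp (v *m M2) v.
    by rewrite !quad_dotp.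
  (* The hypothesis on [Lt] concerns nonzero [v]; at [v = 0] both forms vanish. *)
  have [v0|v0] := eqVneq v 0; first by rewrite v0; exact: q0.
  by move: Ltlt; rewrite -(LtE v Kv v0) => -[_ /(_ l lL)]; exact: qv.
set S := hess_lag g lt yb.
pose act (i : 'I_p) := G zb ord0 i == 0.
pose C := sheared_graph (critical_gens g yb a ys) act S.
have CT : C `<=` tangent_cone (Dhat g) (Phat phi G zb).
  exact: sheared_graph_tangent.
have Dphi : differentiable phi zb by exact: C1_differentiable.
have DG : differentiable G zb by exact: C1_differentiable.
set A := jac (Phat phi G) zb in subreg2.
(* By the constraint qualification [xi = - grad F zb] lies in the polar of the linearised feasible
   set. *)
have xiP d : tangent_cone (Dhat g) (Phat phi G zb) (d *m A) -> 0 <= dotp (grad F zb) d.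
  move=> Td; have -> : grad F zb = - xi by apply/eqP; rewrite -addr_eq0 Fxi.
  by rewrite dotpNl oppr_ge0; move: xiN; rewrite ggcq; apply.
have Cscale t r : 0 < t -> C r -> C (t *: r) by exact: sheared_graph_scale.
have [kappa k0 Hk] := subregular_penalty subreg2 CT Cscale xiP.
have [v [z [n1 [w [mu [Kv Nz cw cn [muT E]]]]]]] := polyhedral_multiplier k0 Hk.
exists v, z, w, mu; rewrite KE; split=> //.
  split=> // x /(tangent_orthant _ s0); exact: muT.
have {}E : grad F zb = - (n1 *m (col_mx 0 1%:M)^T) + w *m (jac phi zb)^T -
    mu *m (jac G zb)^T.
  move/eqP: E; rewrite addr_eq0 => /eqP ->.
  rewrite /A jac_Phat// !tr_row_mx !mul_row_col linearN /= mulmxN.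
  by rewrite !opprD opprK.
have trJ (k l : nat) (x : 'rV[R]_l) (J : 'M[R]_(n + m, l)) :
    x *m J^T = row_mx (x *m (usubmx J)^T) (x *m (dsubmx J)^T).
  by rewrite -mul_mx_row -tr_col_mx vsubmxK.
rewrite E !(trJ 0%N) col_mxKu col_mxKd trmx0 mulmx0 trmx1 mulmx1.
rewrite !(opp_row_mx, add_row_mx) row_mxKl row_mxKr; split.
  by rewrite oppr0 add0r addrAC subrK subrr.
(* The shear left [w *m S^T] inside the polar element: it cancels the Hessian term of the second
   equation, while [n1] cancels the contribution of the identity block of the Jacobian. *)
exists (n1 + w *m S^T) => //.
have cancel (x W Z X : 'rV[R]_m) : 0 = - x + W - Z - X - W + Z + (x + X).
  by apply/rowP => i; rewrite !mxE; ring.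
exact: cancel.
Qed.
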